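(* Suppose $L_T\lesssim 1/\sqrt T$. Then the algorithm Perishing-Guardrail, run with envy parameter $L_T$ and high-probability parameter $\delta\in(0,1)$, achieves with probability at least $1-2\delta$: $$\Delta_{EF}\lesssim \mathcal L^{\mathrm{perish}}+1/\sqrt T,\qquad \Delta_{\mathrm{efficiency}}\lesssim\sqrt T+T\mathcal L^{\mathrm{perish}} .$$
   Context: Model. A decision-maker has a set $\mathcal B$ of $B$ divisible units of a single resource to allocate over rounds $t\in[T]=\{1,\dots,T\}$. Individuals have types in a finite set $\Theta$; type $\theta$ has utility $w_\theta x$ for an amount $x\ge0$, $w_\theta>0$. In round $t$ a random number $N_{t,\theta}$ of type-$\theta$ individuals arrives; the $N_{t,\theta}$ are independent with known distributions and $N_{t,\theta}\ge1$ a.s. $N_t=\sum_\theta N_{t,\theta}$, $N=\sum_{t\in[T]}N_t$, $\mathbb E[N]=\Theta(T)$, $\beta_{avg}=B/\mathbb E[N]=\Theta(1)$. $\sigma_{t,\theta}^2=\mathrm{Var}(N_{t,\theta})<\infty$; $\rho_{t,\theta}<\infty$ is an almost sure bound on $|N_{t,\theta}-\mathbb E[N_{t,\theta}]|$; $w_{max}=\max_\theta w_\theta$, $\mu_{\max}=\max_t\mathbb E[N_t]$, $\sigma^2_{\min}=\min\sigma^2_{t,\theta}$, $\sigma^2_{\max}=\max\sigma^2_{t,\theta}$, $\rho_{\max}=\max\rho_{t,\theta}$. Unit $b$ has a random perishing time $T_b\in\{1,2,\dots\}$ with known distribution, independent across units and of arrivals; any unallocated part of $b$ spoils at the end of round $T_b$,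 after that round's allocation. A fixed allocation schedule is a bijection $\sigma:\mathcal B\to\{1,\dots,B\}$; units are handed out in increasing order of $\sigma$ among those still (partly) unallocated and unspoiled. $X^{alg}_{t,\theta}$ is the amount given to each type-$\theta$ individual in round $t$; $B_1^{alg}=B$ and $B_{t+1}^{alg}=B_t^{alg}-\sum_\theta N_{t,\theta}X^{alg}_{t,\theta}-PUA^{alg}_t$, with $PUA_t^{alg}$ the quantity of unallocated resource perishing at the end of round $t$. For time-indexed $Y_t$: $Y_{<t}=\sum_{t'<t}Y_{t'}$, and similarly $Y_{\le t},Y_{>t},Y_{\ge t},Y_{(t,t']},Y_{[t,t']}$. Metrics. $\Delta_{EF}=\max_{t,\theta}|w_\theta(X^{alg}_{t,\theta}-B/N)|$; $\Delta_{\mathrm{efficiency}}=B-\sum_{t,\theta}N_{t,\theta}X^{alg}_{t,\theta}$. Confidence terms. For $t'>t$, $\mathrm{Conf}^N_{t,t'}=\sqrt{2(t'-t)|\Theta|\rho_{\max}^2\log(2T^2/\delta)}$ ($\mathrm{Conf}^N_{t,t}=0$), and $\mathrm{Conf}^P_t(\eta)=\frac12\big(\log(3t\log T/\delta)+\sqrt{\log^2(3t\log T/\delta)+8\eta\log(3t\log T/\delta)}\big)$. Forecasts. $\overline N=\mathbb E[N]+\mathrm{Conf}^N_{0,T}$, $\overline N_{>t}=\mathbb E[N_{>t}]+\mathrm{Conf}^N_{t,T}$, $\underline N_{[t,t']}=\mathbb E[N_{[t,t']}]-\mathrm{Conf}^N_{t-1,t'}$, $\underline N_{\le t}=\underline N_{[1,t]}$,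 $\underline N_{<t}=\underline N_{[1,t-1]}$ ($\underline N_{<1}=0$). For $X\ge0$, $$\tau_b(t\mid X,\sigma)=\inf\{t'\ge t:\underline N_{<t}X+\underline N_{[t,t']}X\ge\sigma(b)\}\ (\inf\emptyset=\infty),\ \text{and for } t=1:\ \tau_b(1\mid X,\sigma)=\inf\{t'\ge1:\underline N_{\le t'}X\ge\sigma(b)\},$$ $$\mu(X)=\sum_{b\in\mathcal B}\Pr(T_b<\min\{T,\tau_b(1\mid X,\sigma)\}),\quad \overline\Delta(X)=\min\{B,\mu(X)+\mathrm{Conf}^P_1(\mu(X))\},$$ $$\underline X=\sup\{X\mid X\le (B-\overline\Delta(X))/\overline N\}\ \text{(assumed attained)},\quad \mathcal L^{\mathrm{perish}}=B/\overline N-\underline X .$$ $\overline{\mathcal B}_t$ is the set of units of rank at least $\lceil\underline N_{<t}\underline X\rceil$ in $\sigma$, $\eta_t=\sum_{b\in\overline{\mathcal B}_t}\Pr(t\le T_b<\min\{T,\tau_b(t\mid\underline X,\sigma)\})$, $\overline P_0=B$, $\overline P_t=\min\{\overline P_{t-1},\eta_t+\mathrm{Conf}^P_t(\eta_t)\}$. Algorithm Perishing-Guardrail. Input $L_T=o(1)$. Set $\overline X=\underline X+L_T$. In each round $t=1,\dots,T$, after observing $N_t$: if $B_t^{alg}<N_t\underline X$, set $X^{alg}_{t,\theta}=B_t^{alg}/N_t$ for all $\theta$; else if $B_t^{alg}-N_t\overline X\ge\underline X\,\overline N_{>t}+\overline P_t$, set $X^{alg}_{t,\theta}=\overline X$ for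 all $\theta$; else set $X_{t,\theta}^{alg}=\underline X$ for all $\theta$. Allocate the remaining units according to $\sigma$. Notation. $\lesssim$ means that the inequality holds as $T$ grows up to absolute constants and polynomial factors of $\beta_{avg},|\Theta|,w_{max},\mu_{\max},\sigma^2_{\min},\sigma^2_{\max},\rho_{\max},\log T,\log(1/\delta)$. *)

(* Defs.v *)
(* MathComp world, with MathComp-Analysis. *)
From HB Require Import structures.
From mathcomp Require Import all_boot all_order all_fingroup all_algebra.
From mathcomp Require Import all_classical all_reals all_analysis.
(* The notations of mpoly clash with those of MathComp-Analysis. *)
From mathcomp Require Import(canonicals,coercions) mpoly.

Set Implicit Arguments.
Unset Strict Implicit.
Unset Printing Implicit Defensive.

Import Order.TTheory GRing.Theory Num.Theory.
Import numFieldNormedType.Exports.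

Local Open Scope classical_set_scope.
Local Open Scope ring_scope.

(* Mutual independence of a finite family of nat-valued random variables
   (every set of naturals is measurable). *)
Definition mutual_independence d (Omega : measurableType d) (R : realType)
    (P : probability Omega R) (K : finType) (X : K -> {RV P >-> nat}) : Prop :=
  forall (J : {set K}) (A : K -> set nat),
    P (\bigcap_(k in [set k | k \in J]) (X k @^-1` A k)) =
    (\prod_(k in J) P (X k @^-1` A k))%E.

(* Rounds are 1, ..., T: [narr t th] and [rho t th] are only ever used for
   (1 <= t <= T).  The B units are the elements of ['I_nunits]; [sched] is the
   schedule, and unit b has rank (sched b).+1 in {1, ..., B}. *)
Record instance (R : realType) (T : nat) := Instance {
  disp : measure_display;
  Omega : measurableType disp;
  Pr : probability Omega R;
  Theta : finType;
  weight : Theta -> R;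
  narr : nat -> Theta -> {RV Pr >-> nat};
  rho : nat -> Theta -> R;
  nunits : nat;
  perish : 'I_nunits -> {RV Pr >-> nat};
  sched : {perm 'I_nunits}
}.

Definition mean (R : realType) (T : nat) (M : instance R T)
    (X : Omega M -> R) : R := fine 'E_(Pr M)[X]%E.

Definition narrR (R : realType) (T : nat) (M : instance R T)
    (t : nat) (th : Theta M) (om : Omega M) : R := (narr t th om)%:R.

(* N_{[t,t']} *)
Definition arrivals (R : realType) (T : nat) (M : instance R T)
    (t t' : nat) (om : Omega M) : R :=
  \sum_(t <= s < t'.+1) \sum_(th : Theta M) narrR s th om.

Definition meanN (R : realType) (T : nat) (M : instance R T) (t t' : nat) : R :=
  mean (arrivals (M := M) t t').

Definition primitives (R : realType) (T : nat) (M : instance R T)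
    (k : ('I_T * Theta M) + 'I_(nunits M)) : {RV (Pr M) >-> nat} :=
  match k with
  | inl (t, th) => narr t.+1 th
  | inr b => perish b
  end.

Record admissible (R : realType) (T : nat) (M : instance R T) : Prop := {
  weight_gt0 : forall th : Theta M, 0 < weight th;
  narr_ge1 : forall (t : nat) (th : Theta M), (1 <= t <= T)%N ->
    \forall om \ae Pr M, (1 <= narr t th om)%N;
  narr_var : forall (t : nat) (th : Theta M), (1 <= t <= T)%N ->
    ('V_(Pr M)[narrR t th] < +oo)%E;
  narr_bound : forall (t : nat) (th : Theta M), (1 <= t <= T)%N ->
    \forall om \ae Pr M, `|narrR t th om - mean (narrR t th)| <= rho t th;
  perish_ge1 : forall (b : 'I_(nunits M)) (om : Omega M), (1 <= perish b om)%N;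
  primitives_indep : mutual_independence (@primitives R T M)
}.

Definition beta_avg (R : realType) (T : nat) (M : instance R T) : R :=
  (nunits M)%:R / meanN M 1 T.

Definition sigma2 (R : realType) (T : nat) (M : instance R T)
    (t : nat) (th : Theta M) : R := fine 'V_(Pr M)[narrR t th]%E.

(* In the maxima below the quantities are nonnegative, so that the default
   value 0 is harmless; the minimum defaults to the maximum. *)
Definition w_max (R : realType) (T : nat) (M : instance R T) : R :=
  \big[Num.max/0]_(th : Theta M) weight th.

Definition mu_max (R : realType) (T : nat) (M : instance R T) : R :=
  \big[Num.max/0]_(1 <= t < T.+1) meanN M t t.

Definition sigma2_max (R : realType) (T : nat) (M : instance R T) : R :=
  \big[Num.max/0]_(1 <= t < T.+1) \big[Num.max/0]_(th : Theta M) sigma2 t th.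

Definition sigma2_min (R : realType) (T : nat) (M : instance R T) : R :=
  \big[Num.min/sigma2_max M]_(1 <= t < T.+1)
    \big[Num.min/sigma2_max M]_(th : Theta M) sigma2 t th.

Definition rho_max (R : realType) (T : nat) (M : instance R T) : R :=
  \big[Num.max/0]_(1 <= t < T.+1) \big[Num.max/0]_(th : Theta M) rho t th.

Definition confN (R : realType) (T : nat) (M : instance R T) (delta : R)
    (t t' : nat) : R :=
  Num.sqrt (2 * (t' - t)%:R * #|Theta M|%:R * rho_max M ^+ 2 *
            ln (2 * T%:R ^+ 2 / delta)).

Definition confP (R : realType) (T : nat) (delta : R) (t : nat) (eta : R) : R :=
  let l := ln (3 * t%:R * ln (T%:R : R) / delta) in
  2^-1 * (l + Num.sqrt (l ^+ 2 + 8 * eta * l)).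

Definition Nup (R : realType) (T : nat) (M : instance R T) (delta : R) : R :=
  meanN M 1 T + confN M delta 0 T.

(* upper forecast of N_{>t} *)
Definition Nup_after (R : realType) (T : nat) (M : instance R T) (delta : R)
    (t : nat) : R :=
  meanN M t.+1 T + confN M delta t T.

(* lower forecast of N_{[t,t']}; those of N_{<t} and N_{<=t} are
   [Nlow 1 t.-1] and [Nlow 1 t], and [Nlow 1 0 = 0] *)
Definition Nlow (R : realType) (T : nat) (M : instance R T) (delta : R)
    (t t' : nat) : R :=
  meanN M t t' - confN M delta t.-1 t'.

Definition unit_rank (R : realType) (T : nat) (M : instance R T)
    (b : 'I_(nunits M)) : nat := (sched M b).+1.

(* t' ranges over the rounds.  For t = 1 the first summand vanishes, which
   gives the formula for tau_b(1 | X, sigma). *)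
Definition tau (R : realType) (T : nat) (M : instance R T) (delta : R)
    (t : nat) (X : R) (b : 'I_(nunits M)) : \bar R :=
  ereal_inf [set (t'%:R)%:E | t' in [set t' : nat | (t <= t' <= T)%N /\
    Nlow M delta 1 t.-1 * X + Nlow M delta t t' * X >= (unit_rank b)%:R]].

(* the event T_b < min{T, tau_b(t | X, sigma)} *)
Definition perish_before (R : realType) (T : nat) (M : instance R T)
    (delta : R) (t : nat) (X : R) (b : 'I_(nunits M)) : set (Omega M) :=
  [set om | (((perish b om)%:R)%:E < Order.min (T%:R)%:E (tau delta t X b))%E].

Definition mu_perish (R : realType) (T : nat) (M : instance R T) (delta : R)
    (X : R) : R :=
  \sum_(b < nunits M) fine (Pr M (perish_before delta 1 X b)).

Definition Delta_bar (R : realType) (T : nat) (M : instance R T) (delta : R)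
    (X : R) : R :=
  Num.min (nunits M)%:R
    (mu_perish M delta X + confP T delta 1 (mu_perish M delta X)).

Definition feasible_rates (R : realType) (T : nat) (M : instance R T)
    (delta : R) : set R :=
  [set X | 0 <= X /\
    X <= ((nunits M)%:R - Delta_bar M delta X) / Nup M delta].

Definition Xlow (R : realType) (T : nat) (M : instance R T) (delta : R) : R :=
  sup (feasible_rates M delta).

Definition Lperish (R : realType) (T : nat) (M : instance R T) (delta : R) : R :=
  (nunits M)%:R / Nup M delta - Xlow M delta.

Definition eta (R : realType) (T : nat) (M : instance R T) (delta : R)
    (t : nat) : R :=
  \sum_(b < nunits M |
        Num.ceil (Nlow M delta 1 t.-1 * Xlow M delta) <= (unit_rank b)%:Z)
    fine (Pr M ([set om | (t <= perish b om)%N] `&`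
                perish_before delta t (Xlow M delta) b)).

Fixpoint Pup (R : realType) (T : nat) (M : instance R T) (delta : R)
    (t : nat) : R :=
  match t with
  | 0%N => (nunits M)%:R
  | t'.+1 => Num.min (Pup M delta t')
               (eta M delta t + confP T delta t (eta M delta t))
  end.

(* The amount Perishing-Guardrail gives in round t to each individual,
   whatever their type, when the current budget B_t^alg is [budget]. *)
Definition guardrail (R : realType) (T : nat) (M : instance R T) (delta L : R)
    (t : nat) (om : Omega M) (budget : R) : R :=
  let Nt := arrivals t t om in
  let X := Xlow M delta in
  if budget < Nt * X then budget / Nt
  else if budget - Nt * (X + L) >= X * Nup_after M delta t + Pup M delta t
  then X + L
  else X.

(* What is taken from unit b when a total amount [a] is handed out in order of
   rank, the remaining amounts of the units being [r]. *)
Definition handed (R : realType) (T : nat) (M : instance R T)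
    (r : 'I_(nunits M) -> R) (a : R) (b : 'I_(nunits M)) : R :=
  Num.min (r b)
    (Num.max 0 (a - \sum_(b' < nunits M | (unit_rank b' < unit_rank b)%N) r b')).

(* The state at the start of a round: B_t^alg and, for each unit, the amount
   of it that is neither allocated nor spoiled. *)
Definition step (R : realType) (T : nat) (M : instance R T) (delta L : R)
    (om : Omega M) (t : nat) (st : R * ('I_(nunits M) -> R)) :
    R * ('I_(nunits M) -> R) :=
  let X := guardrail delta L t om st.1 in
  let a := \sum_(th : Theta M) narrR t th om * X in
  let rest := fun b => st.2 b - handed st.2 a b in
  let pua := \sum_(b < nunits M | perish b om == t) rest b in
  (st.1 - a - pua, fun b => if perish b om == t then 0 else rest b).

(* [state delta L om t] is the state after t rounds, i.e. at the start of
   round t.+1. *)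
Fixpoint state (R : realType) (T : nat) (M : instance R T) (delta L : R)
    (om : Omega M) (t : nat) : R * ('I_(nunits M) -> R) :=
  match t with
  | 0%N => ((nunits M)%:R, fun=> 1)
  | t'.+1 => step delta L om t (state delta L om t')
  end.

(* X^alg_{t,theta} *)
Definition Xalg (R : realType) (T : nat) (M : instance R T) (delta L : R)
    (t : nat) (th : Theta M) (om : Omega M) : R :=
  guardrail delta L t om (state delta L om t.-1).1.

Definition Delta_EF (R : realType) (T : nat) (M : instance R T) (delta L : R)
    (om : Omega M) : R :=
  \big[Num.max/0]_(1 <= t < T.+1) \big[Num.max/0]_(th : Theta M)
    `|weight th * (Xalg delta L t th om - (nunits M)%:R / arrivals 1 T om)|.

Definition Delta_eff (R : realType) (T : nat) (M : instance R T) (delta L : R)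
    (om : Omega M) : R :=
  (nunits M)%:R -
  \sum_(1 <= t < T.+1) \sum_(th : Theta M) narrR t th om * Xalg delta L t th om.

(* the value of the polynomial p at beta_avg, |Theta|, w_max, mu_max,
   sigma^2_min, sigma^2_max, rho_max, log T and log(1/delta) *)
Definition poly_factor (R : realType) (p : mpoly.mpoly 9 R) (T : nat)
    (M : instance R T) (delta : R) : R :=
  mpoly.meval
    (fun i : 'I_9 => nth 0
       [:: beta_avg M; #|Theta M|%:R; w_max M; mu_max M; sigma2_min M;
           sigma2_max M; rho_max M; ln T%:R; ln delta^-1] i)
    p.

(* Main.v *)
(* Since both rates offered are at least Xlow, everything follows once the budget
   is shown never to run out.  A unit of rank r that is still unallocated when
   it perishes at time t satisfies r > A, where A is the total handed out up to
   round t; if all rates so far are at least Xlow and the arrivals are at least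
   their lower forecasts, this puts the unit among those counted by eta, so what
   can still spoil is at most Pup.  Hence the invariant
     B_t >= Xlow * N_{>= t} + (what can still spoil from round t on)
   propagates, whichever of the two rates is chosen, and every rate is Xlow or
   Xlow + L.  Then |X - B/N| <= Lperish + L + |B/Nup - B/N|, and the waste is at
   most B - N * Xlow, where |N - Nup| is of order sqrt T.

   The arrival forecasts hold with probability 1 - delta by Hoeffding's
   inequality and a union bound over the T^2 intervals, two tails each of mass
   delta / (2 T^2).  The perishing forecasts fail in round t with probability at
   most delta / (3 t ln T) by the Chernoff bound
   P(S >= eta + eps) <= exp(- eps^2 / (2 eta + eps)), and these sum to at most
   delta.  The laws are discretized to a finite type, on which exponential
   moments of independent variables factor as finite sums. *)
Require Import Defs.
From HB Require Import structures.
From mathcomp Require Import all_boot all_order all_fingroup all_algebra.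
From mathcomp Require Import all_classical all_reals all_analysis.
From mathcomp Require Import measurable_realfun.
From mathcomp Require Import(canonicals,coercions) mpoly.
From mathcomp Require Import ring lra.

Set Implicit Arguments.
Unset Strict Implicit.
Unset Printing Implicit Defensive.

Import Order.TTheory GRing.Theory Num.Theory.
Import numFieldNormedType.Exports.

Local Open Scope classical_set_scope.
Local Open Scope ring_scope.

(** * Exponential inequalities *)

Lemma ge0_derive_le (R : realType) (f df : R -> R) (x : R) :
  (forall y, is_derive y (1 : R) f (df y)) -> (forall y, 0 <= y -> 0 <= df y) ->
  0 <= x -> f 0 <= f x.
Proof.
move=> dfE df0 x0.
have cf : {within `[0, x], continuous f}.
  apply: derivable_within_continuous => y _; exact: (@ex_derive _ _ _ _ _ _ _ (dfE y)).
have [c /andP[c0 _] fE] := MVT_segment x0 (fun y _ => dfE y) cf.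
by rewrite -subr_ge0 fE mulr_ge0 ?subr_ge0 ?df0.
Qed.

(** The derivative of [2 + y - (2 - y) * expR y] is [1 - (1 - y) * expR y], nonnegative because
    [1 - y <= expR (- y)]. This rational bound makes the Chernoff exponent computable by algebra
    alone. *)
Lemma expR_le_ratio (R : realType) (x : R) :
  0 <= x -> (2 - x) * expR x <= 2 + x.
Proof.
move=> x0; pose f (y : R) : R := 2 + y - (2 - y) * expR y.
suff : f 0 <= f x by rewrite /f !(subr0, addr0, expR0, mulr1) subrr subr_ge0.
apply: (@ge0_derive_le _ f (fun y => 1 - (1 - y) * expR y)) => // [y|y _].
  apply: is_derive_eq; rewrite /GRing.scale/=; ring.
rewrite subr_ge0; have := expR_ge1Dx (- y); rewrite expRN => h.
by rewrite -ler_pdivlMr ?expR_gt0// div1r.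
Qed.

(** Two monotonicity arguments: [y * c y - s y] has derivative [y * s y], and, times
    [expR (- (y ^+ 2 / 2))], it is itself the derivative of [phi], where [phi 0 = - 2]. *)
Lemma cosh_le_gauss (R : realType) (x : R) :
  expR x + expR (- x) <= 2 * expR (x ^+ 2 / 2).
Proof.
wlog x0 : x / 0 <= x => [H|].
  have [/H//|/ltW x0] := leP 0 x.
  by have := H (- x); rewrite opprK sqrrN addrC oppr_ge0; exact.
pose c (y : R) : R := expR y + expR (- y).
pose s (y : R) : R := expR y - expR (- y).
have s_ge0 y : 0 <= y -> 0 <= s y.
  by move=> y0; rewrite subr_ge0 ler_expR; lra.
have psi_ge0 y : 0 <= y -> s y <= y * c y.
  move=> y0; rewrite -subr_ge0.
  pose psi z := z * c z - s z.
  suff : psi 0 <= psi y by rewrite {1}/psi /s mul0r oppr0 subrr subr0.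
  apply: (@ge0_derive_le _ psi (fun z => z * s z)) => // [z|z z0]; last first.
    by rewrite mulr_ge0// s_ge0.
  rewrite /psi /c /s; apply: is_derive_eq.
  rewrite /GRing.scale/=; ring.
pose phi (y : R) : R := - (c y * expR (- (y ^+ 2 / 2))).
have : phi 0 <= phi x.
  apply: (@ge0_derive_le _ phi (fun y => (y * c y - s y) * expR (- (y ^+ 2 / 2)))) => // [y|y y0].
    rewrite /phi /c /s; apply: is_derive_eq.
    rewrite /GRing.scale/= /s/c; by field.
  by rewrite mulr_ge0 ?expR_ge0// subr_ge0 psi_ge0.
rewrite /phi /c expr0n/= mul0r oppr0 expR0 mulr1 lerN2 [expR (- (_ / _))]expRN.
by rewrite ler_pdivrMr ?expR_gt0//; lra.
Qed.

(** By convexity [expR (lam * y)] lies below its chord over the interval from [- rho] to [rho]; mean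
    zero removes the linear part of the chord and leaves the cosh of [lam * rho]. Values of mass
    zero are exempt from the bound, since a truncated range may contain some that are too far
    out. *)
Lemma hoeffding_lemma (R : realType) (F : finType) (p v : F -> R) (rho lam : R) :
  (forall j, 0 <= p j) -> \sum_j p j = 1 -> \sum_j p j * v j = 0 ->
  (forall j, p j != 0 -> `|v j| <= rho) -> 0 < rho ->
  \sum_j expR (lam * v j) * p j <= expR (lam ^+ 2 * rho ^+ 2 / 2).
Proof.
move=> p0 p1 pv vrho rho0.
pose e1 := expR (lam * rho); pose e2 := expR (- (lam * rho)).
have chord y : `|y| <= rho ->
    expR (lam * y) <= (rho + y) / (2 * rho) * e1 + (rho - y) / (2 * rho) * e2.
  rewrite ler_norml => /andP[y1 y2].
  have t01 : 0 <= (rho + y) / (2 * rho) <= 1.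
    by rewrite divr_ge0 /= ?ler_pdivrMr; lra.
  have /andP[t0 t1] := t01.
  have := @convex_expR R (Itv01 t0 t1) (lam * rho) (- (lam * rho)).
  rewrite !convRE /= /unstable.onem -/e1 -/e2.
  have -> : 1 - (rho + y) / (2 * rho) = (rho - y) / (2 * rho) by field; lra.
  congr (expR _ <= _); field; lra.
apply: (@le_trans _ _ (\sum_j ((e1 + e2) / 2 * p j + (e1 - e2) / (2 * rho) * (p j * v j)))).
  apply: ler_sum => j _; have [->|/vrho/chord h] := eqVneq (p j) 0.
    by rewrite !(mul0r, mulr0) addr0.
  have := ler_wpM2r (p0 j) h; congr (_ <= _); field; lra.
rewrite big_split/= -!mulr_sumr p1 pv mulr0 addr0 mulr1 ler_pdivrMr// mulrC.
by have := cosh_le_gauss (lam * rho); rewrite exprMn.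
Qed.

(** * Tail bounds for independent nat-valued random variables *)

Lemma RVnat_preimage_measurable d (Omega : measurableType d) (R : realType)
    (P : probability Omega R) (X : {RV P >-> nat}) (A : set nat) :
  measurable (X @^-1` A).
Proof. exact: measurable_funPTI. Qed.

(** There are countably many vectors of values, and [E] either contains or misses the whole event on
    which [X] takes a given one. *)
Lemma determined_measurable d (Omega : measurableType d) (R : realType)
    (P : probability Omega R) (K : finType) (X : K -> {RV P >-> nat})
    (E : set Omega) :
  (forall om om', (forall k, X k om = X k om') -> E om -> E om') -> measurable E.
Proof.
move=> detE; pose atom (h : {ffun K -> nat}) := \bigcap_(k in setT) (X k @^-1` [set h k]).
have -> : E = \bigcup_(h : {ffun K -> nat}) (E `&` atom h).
  apply/seteqP; split => [om Eom|om [h _ []//]].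
  by exists [ffun k => X k om] => //; split=> // k _; rewrite /= ffunE.
apply: countable_bigcupT_measurable => [|h]; first exact: countableP.
have [[om0 [Eom0 om0h]]|hE] := pselect (exists om, (E `&` atom h) om); last first.
  suff -> : E `&` atom h = set0 by exact: measurable0.
  by apply/seteqP; split => // om Eom; apply: hE; exists om.
have -> : E `&` atom h = atom h.
  apply/seteqP; split => [om []//|om omh]; split=> //.
  by apply: detE Eom0 => k; rewrite (om0h k I) (omh k I).
apply: fin_bigcap_measurable => [|k _]; first exact: finite_finset.
exact: RVnat_preimage_measurable.
Qed.

Lemma finite_union_bound d (Omega : measurableType d) (R : realType)
    (P : probability Omega R) (I : finType) (A : I -> set Omega) (E : set Omega) :
  (forall i, measurable (A i)) -> measurable E -> E `<=` \bigcup_i A i ->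
  (P E <= \sum_i P (A i))%E.
Proof.
move=> mA mE EA; rewrite fsbig_seq ?index_enum_uniq//.
apply: content_sub_fsum => //.
by move=> om /EA [i _ Ai]; exists i => //=; rewrite mem_index_enum.
Qed.

(** Markov's inequality on the finite set of vectors [h] of discretized values: each [h] in the
    event has [expR (lam * (\sum_k f k (h k) - c)) >= 1], its probability is a product by
    independence, and the sum over all [h] is the expansion of a product of sums. *)
Lemma exp_tail_bound d (Omega : measurableType d) (R : realType)
    (P : probability Omega R) (K F : finType) (X : K -> {RV P >-> nat})
    (g : K -> nat -> F) (f : K -> F -> R) (c lam : R) :
  mutual_independence X -> 0 <= lam ->
  (P [set om | (c < \sum_k f k (g k (X k om)))%R] <=
   (expR (- (lam * c)) *
    \prod_k \sum_j expR (lam * f k j) *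
                   fine (P (X k @^-1` (g k @^-1` [set j]))))%:E)%E.
Proof.
move=> indep lam0.
pose A (h : {ffun K -> F}) : set Omega :=
  \bigcap_(k in [set k | k \in [set: K]%SET]) (X k @^-1` (g k @^-1` [set h k])).
pose A' (h : {ffun K -> F}) : set Omega :=
  if c < \sum_k f k (h k) then A h else set0.
have mA h : measurable (A h).
  apply: fin_bigcap_measurable => [|k _]; first exact: finite_finset.
  exact: RVnat_preimage_measurable.
have PA h : P (A h) = (\prod_k fine (P (X k @^-1` (g k @^-1` [set h k]))))%:E.
  rewrite indep -prodEFin; apply: eq_big => k; first by rewrite inE.
  by move=> _; rewrite fineK// fin_num_measure//; exact: RVnat_preimage_measurable.
have le1 : (P [set om | (c < \sum_k f k (g k (X k om)))%R] <= \sum_h P (A' h))%E.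
  apply: finite_union_bound => [h| |om /= cS].
  - by rewrite /A'; case: ifP => // _.
  - by apply: (determined_measurable (X := X)) => om om' eqX /=;
      under eq_bigr do rewrite eqX.
  - exists [ffun k => g k (X k om)] => //; rewrite /A'.
    under eq_bigr do rewrite ffunE.
    by rewrite cS => k _ /=; rewrite ffunE.
apply: (le_trans le1).
rewrite bigA_distr_bigA/= mulr_sumr -sumEFin.
apply: lee_sum => h _; rewrite /A'; case: ifPn => ch; last first.
  rewrite measure0 lee_fin mulr_ge0 ?expR_ge0 ?prodr_ge0// => k _.
  by rewrite mulr_ge0 ?expR_ge0 ?fine_ge0.
rewrite PA lee_fin big_split/= mulrA -expR_sum -expRD -mulr_sumr.
apply: ler_peMl; first by apply: prodr_ge0 => k _; exact/fine_ge0/measure_ge0.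
by rewrite -expR0 ler_expR addrC -mulrBr mulr_ge0// subr_ge0 ltW.
Qed.

Lemma ae_set0 d (Omega : measurableType d) (R : realType)
    (P : probability Omega R) (Q : set Omega) :
  measurable Q -> (\forall om \ae P, Q om) -> P (~` Q) = 0.
Proof. by move=> mQ aeQ; apply: measure_negligible => //; exact: measurableC. Qed.

Lemma RVnat_comp_measurable d (Omega : measurableType d) (R : realType)
    (P : probability Omega R) (X : {RV P >-> nat}) (h : nat -> R) :
  measurable_fun setT (EFin \o (fun om => h (X om))).
Proof.
apply/measurable_EFinP => _ Y mY; rewrite setTI.
exact: (RVnat_preimage_measurable X (h @^-1` Y)).
Qed.

Lemma finite_expectation d (Omega : measurableType d) (R : realType)
    (P : probability Omega R) (X : {RV P >-> nat}) (F : finType) (g : nat -> F)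
    (h : F -> R) : (forall j, 0 <= h j) ->
  'E_P[fun om => h (g (X om))]%E =
  (\sum_j fine (P (X @^-1` (g @^-1` [set j]))) * h j)%:E.
Proof.
move=> h0; rewrite unlock.
pose A j : set Omega := X @^-1` (g @^-1` [set j]).
have mA j : measurable (A j) by exact: RVnat_preimage_measurable.
have hE om : (h (g (X om)))%:E = \sum_j ((h j)%:E * (\1_(A j) om)%:E)%E :> \bar R.
  rewrite (bigD1 (g (X om)))//= big1 ?adde0.
    by rewrite indicE mem_set// mule1.
  move=> j jg; rewrite indicE memNset ?mule0// => /= gj.
  by rewrite -gj eqxx in jg.
under eq_integral do rewrite hE.
rewrite ge0_integral_sum//.
- rewrite -sumEFin; apply: eq_bigr => j _.
  rewrite ge0_integralZl_EFin//.
  + rewrite integral_indic// setIT EFinM muleC fineK//; exact: (fin_num_measure P _ (mA j)).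
  + by apply/measurable_EFinP; exact: measurable_indic.
- move=> j; apply: measurable_funeM.
  by apply/measurable_EFinP; exact: measurable_indic.
- by move=> j om _; rewrite mule_ge0// lee_fin.
Qed.

(** Truncation at [m] alters the variable only on a null set and leaves finitely many values. *)
Lemma bounded_expectation d (Omega : measurableType d) (R : realType)
    (P : probability Omega R) (X : {RV P >-> nat}) (m : nat) :
  (\forall om \ae P, (X om <= m)%N) ->
  'E_P[fun om => (X om)%:R]%E =
  (\sum_(j < m.+1) fine (P (X @^-1` ((fun n => inord (minn n m)) @^-1` [set j])))
     * j%:R)%:E.
Proof.
move=> Xm; rewrite -(finite_expectation X (fun n => inord (minn n m))
  (h := fun j : 'I_m.+1 => j%:R)) ?ler0n//.
rewrite unlock; apply: ge0_ae_eq_integral => //.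
- exact: (RVnat_comp_measurable X (fun n => n%:R)).
- exact: (RVnat_comp_measurable X
    (fun n => ((inord (minn n m) : 'I_m.+1) : nat)%:R)).
- move: Xm; apply: filterS => om /= Xm _.
  by rewrite (minn_idPl Xm) inordK.
Qed.

Lemma finite_prob_sum1 d (Omega : measurableType d) (R : realType)
    (P : probability Omega R) (X : {RV P >-> nat}) (F : finType) (g : nat -> F) :
  \sum_j fine (P (X @^-1` (g @^-1` [set j]))) = 1.
Proof.
have := finite_expectation X g (h := fun=> 1) (fun=> ler01).
rewrite (_ : (fun=> 1) = cst 1)// expectation_cst => -[->].
by apply: eq_bigr => j _; rewrite mulr1.
Qed.

Lemma measureU_null d (Omega : measurableType d) (R : realType)
    (P : probability Omega R) (E A D : set Omega) :
  measurable E -> measurable A -> measurable D -> E `<=` A `|` D -> P D = 0 ->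
  (P E <= P A)%E.
Proof.
move=> mE mA mD EAD D0; apply: (@le_trans _ _ (P (A `|` D))).
  by apply: le_measure; rewrite ?inE//; exact: measurableU.
rewrite -[leRHS]adde0 -D0; exact: measureU2.
Qed.

(** The sign [s] serves both tails. [J] selects the summands within a larger independent family; an
    index outside [J] contributes a factor 1. *)
Lemma hoeffding_tail d (Omega : measurableType d) (R : realType)
    (P : probability Omega R) (K : finType) (X : K -> {RV P >-> nat})
    (J : {set K}) (mu : K -> R) (s rho l : R) :
  mutual_independence X -> 0 <= rho -> 0 <= l -> `|s| = 1 ->
  (forall k, k \in J -> 'E_P[fun om => (X k om)%:R]%E = (mu k)%:E) ->
  (forall k, k \in J -> \forall om \ae P, `|(X k om)%:R - mu k| <= rho) ->
  (P [set om | (Num.sqrt (2 * #|J|%:R * rho ^+ 2 * l) <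
                s * \sum_(k in J) ((X k om)%:R - mu k))%R] <= (expR (- l))%:E)%E.
Proof.
move=> indep rho0 l0 s1 EX Xb.
set E := [set om | _].
(* A common truncation level: almost surely no [X k] with [k \in J] exceeds it. *)
pose m := (\max_k Num.bound (`|mu k| + rho))%N.
pose Q := [set om | forall k, k \in J ->
   `|(X k om)%:R - mu k| <= rho /\ (X k om <= m)%N].
have aeQ : \forall om \ae P, Q om.
  apply: filter_forall => k; have [kJ|kJ] := boolP (k \in J); last first.
    exact: aeW.
  move: (Xb k kJ); apply: filterS => om /= h _; split => //.
  apply: (@leq_trans (Num.bound (`|mu k| + rho))); last exact: leq_bigmax.
  rewrite -(ler_nat R); apply: ltW.
  apply: le_lt_trans (archi_boundP (addr_ge0 (normr_ge0 _) rho0)).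
  rewrite -[leLHS]normr_nat -[X in `|X|](subrK (mu k)) addrC.
  by apply: (le_trans (ler_normD _ _)); rewrite lerD2l.
have mdet (S : set Omega) : (forall om om', (forall k, X k om = X k om') ->
    S om -> S om') -> measurable S by exact: determined_measurable.
have mQ : measurable Q.
  by apply: mdet => om om' eqX Qom k kJ; rewrite -eqX; exact: Qom.
have mE : measurable E.
  apply: mdet => om om' eqX; rewrite /E /=.
  by under eq_bigr do rewrite eqX.
have Q0 := ae_set0 mQ aeQ.
(* The cases [rho = 0] and, further on, [J] empty are settled apart because [lam] divides by
   [#|J|%:R * rho ^+ 2]. *)
have [rhoeq0|rhogt0] := leP rho 0.
  have -> : P E = 0.
    apply/eqP; rewrite eq_le measure_ge0 andbT -Q0.
    apply: le_measure; rewrite ?inE//; first exact: measurableC.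
    move=> om; rewrite {1}/E /= => + Qom; rewrite big1 ?mulr0 ?ltNge ?sqrtr_ge0// => k /Qom[h _].
    by apply/eqP; rewrite -normr_le0 (le_trans h).
  by rewrite lee_fin expR_ge0.
pose g (k : K) (n : nat) : 'I_m.+1 := inord (minn n m).
pose f k (j : 'I_m.+1) : R := if k \in J then s * (j%:R - mu k) else 0.
pose c := Num.sqrt (2 * #|J|%:R * rho ^+ 2 * l).
pose E' := [set om | c < \sum_k f k (g k (X k om))].
have mE' : measurable E'.
  apply: mdet => om om' eqX; rewrite /E' /=.
  by under eq_bigr do rewrite eqX.
have EE' : E `<=` E' `|` ~` Q.
  move=> om Eom; have [Qom|] := pselect (Q om); last by right.
  left; move: Eom; rewrite /E /E' /= -/c mulr_sumr [X in _ < X]big_mkcond/=.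
  congr (_ < _); apply: eq_bigr => k _; rewrite /f /g.
  case: ifP => // kJ; have [_ Xm] := Qom _ kJ.
  by rewrite (minn_idPl Xm) inordK.
apply: (le_trans (measureU_null mE mE' (measurableC mQ) EE' Q0)).
have [J0|J0] := eqVneq #|J| 0%N.
  have -> : E' = set0.
    apply/seteqP; split => // om; rewrite /E' /= big1 ?ltNge ?sqrtr_ge0// => k _.
    by rewrite /f ifF//; move/eqP: J0; rewrite cards_eq0 => /eqP ->; rewrite inE.
  by rewrite measure0 lee_fin expR_ge0.
have Jgt0 : 0 < #|J|%:R :> R by rewrite ltr0n lt0n.
have D0 : 0 < #|J|%:R * rho ^+ 2 by rewrite mulr_gt0 ?exprn_gt0.
(* The minimizer of the exponent [- (lam * c) + #|J|%:R * (lam ^+ 2 * rho ^+ 2 / 2)]. *)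
pose lam := c / (#|J|%:R * rho ^+ 2).
have lam0 : 0 <= lam by rewrite divr_ge0 ?sqrtr_ge0 ?ltW.
apply: (le_trans (exp_tail_bound g f c indep lam0)).
rewrite lee_fin.
have fac k : \sum_j expR (lam * f k j) * fine (P (X k @^-1` (g k @^-1` [set j])))
    <= if k \in J then expR (lam ^+ 2 * rho ^+ 2 / 2) else 1.
  case: ifPn => kJ; last first.
    rewrite /f (negbTE kJ) mulr0 expR0; under eq_bigr do rewrite mul1r.
    by rewrite finite_prob_sum1.
  rewrite /f kJ; apply: hoeffding_lemma => //.
  - by move=> j; exact/fine_ge0/measure_ge0.
  - exact: finite_prob_sum1.
  - have := EX k kJ; rewrite (@bounded_expectation _ _ _ _ _ m) => [[] Emu|].
      under eq_bigr do rewrite mulrCA mulrBr.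
      by rewrite -mulr_sumr sumrB Emu -mulr_suml finite_prob_sum1 mul1r subrr mulr0.
    by move: aeQ; apply: filterS => om Qom; case: (Qom _ kJ).
  - move=> j; rewrite normrM s1 mul1r; apply: contraNT; rewrite -ltNge => jrho.
    suff -> : P (X k @^-1` (g k @^-1` [set j])) = 0 by [].
    apply/eqP; rewrite eq_le measure_ge0 andbT -Q0.
    apply: le_measure; rewrite ?inE//.
    + exact: RVnat_preimage_measurable.
    + exact: measurableC.
    + move=> om /= gX Qom; have [Xrho Xm] := Qom _ kJ.
      move: jrho; rewrite -gX /g (minn_idPl Xm) inordK// ltNge.
      by rewrite Xrho.
apply: (@le_trans _ _ (expR (- (lam * c)) *
    \prod_k if k \in J then expR (lam ^+ 2 * rho ^+ 2 / 2) else 1)).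
  rewrite ler_wpM2l ?expR_ge0//; apply: ler_prod => k _; rewrite fac andbT.
  by apply: sumr_ge0 => j _; rewrite mulr_ge0 ?expR_ge0//; exact/fine_ge0/measure_ge0.
rewrite -big_mkcond/= prodr_const -expRM_natl -expRD ler_expR.
have c2 : c ^+ 2 = 2 * #|J|%:R * rho ^+ 2 * l.
  by rewrite sqr_sqrtr// !mulr_ge0// ltW.
have -> : - (lam * c) + #|J|%:R * (lam ^+ 2 * rho ^+ 2 / 2) =
          - (c ^+ 2 / (2 * (#|J|%:R * rho ^+ 2))).
  rewrite /lam; field; by rewrite !lt0r_neq0.
by rewrite c2 lerN2 ler_pdivlMr; lra.
Qed.

(** An indicator of mean [p] has exponential moment [1 + p * (expR lam - 1) <= expR (p * (expR lam -
    1))]. In place of the optimal [lam = ln (1 + eps / eta)] its rational lower bound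
    [2 * eps / (2 * eta + eps)] is taken, for which [expR_le_ratio] yields
    [eta * (expR lam - 1) <= eps]. *)
Lemma chernoff_tail d (Omega : measurableType d) (R : realType)
    (P : probability Omega R) (K : finType) (X : K -> {RV P >-> nat})
    (A : K -> set nat) (l : R) :
  let eta := \sum_k fine (P (X k @^-1` A k)) in
  mutual_independence X -> 0 <= l ->
  (P [set om | (eta + 2^-1 * (l + Num.sqrt (l ^+ 2 + 8 * eta * l)) <
                \sum_k (`[< A k (X k om) >])%:R)%R] <= (expR (- l))%:E)%E.
Proof.
move=> eta indep l0; set eps := 2^-1 * _; set E := [set om | _].
have p0 k : 0 <= fine (P (X k @^-1` A k)) by exact/fine_ge0/measure_ge0.
have eta0 : 0 <= eta by exact: sumr_ge0.
(* For [l = 0] the bound is 1; [eps] is then 0 and the denominator [2 * eta + eps] could vanish. *)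
have [->|lneq0] := eqVneq l 0.
  rewrite oppr0 expR0 probability_le1//.
  apply: (determined_measurable (X := X)) => om om' eqX; rewrite /E /=.
  by under eq_bigr do rewrite eqX.
have lgt0 : 0 < l by rewrite lt_def lneq0.
have disc0 : 0 <= l ^+ 2 + 8 * eta * l by rewrite addr_ge0 ?sqr_ge0// !mulr_ge0.
(* [eps] is chosen so that the exponent [eps ^+ 2 / (2 * eta + eps)] is [l]. *)
have epsE : eps ^+ 2 = l * (2 * eta + eps).
  have := sqr_sqrtr disc0; rewrite /eps.
  set q := Num.sqrt _ => qE; rewrite exprMn sqrrD qE; by field.
have epsgt0 : 0 < eps by rewrite mulr_gt0 ?invr_gt0// ltr_wpDr ?sqrtr_ge0.
have den0 : 0 < 2 * eta + eps by rewrite ltr_wpDl ?mulr_ge0.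
pose lam := 2 * eps / (2 * eta + eps).
have lam0 : 0 <= lam by apply: divr_ge0; [apply: mulr_ge0 => //|]; exact: ltW.
pose g k (n : nat) : bool := `[< A k n >].
have := exp_tail_bound g (fun _ (b : bool) => b%:R) (eta + eps) indep lam0.
move=> /le_trans; apply; rewrite lee_fin.
have fac k : \sum_(b : bool) expR (lam * b%:R) * fine (P (X k @^-1` (g k @^-1` [set b])))
    <= expR (fine (P (X k @^-1` A k)) * (expR lam - 1)).
  have gT : g k @^-1` [set true] = A k.
    by apply/seteqP; split => n /=; [move/asboolP|move=> ?; exact/asboolP].
  have := finite_prob_sum1 (X k) (g k).
  rewrite !big_bool/= gT mulr1 mulr0 expR0 mul1r.
  set p := fine (P (X k @^-1` A k)); set q := fine _ => pq.
  apply: le_trans (expR_ge1Dx _); lra.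
apply: (@le_trans _ _ (expR (- (lam * (eta + eps))) *
    \prod_k expR (fine (P (X k @^-1` A k)) * (expR lam - 1)))).
  rewrite ler_wpM2l ?expR_ge0//; apply: ler_prod => k _; rewrite fac andbT.
  by apply: sumr_ge0 => j _; rewrite mulr_ge0 ?expR_ge0//; exact/fine_ge0/measure_ge0.
rewrite -expR_sum -mulr_suml -/eta -expRD ler_expR.
have etalam : eta * (expR lam - 1) <= eps.
  have := expR_le_ratio lam0.
  have -> : 2 - lam = 4 * eta / (2 * eta + eps) by rewrite /lam; field; rewrite lt0r_neq0.
  have -> : 2 + lam = (4 * eta + 4 * eps) / (2 * eta + eps).
    by rewrite /lam; field; rewrite lt0r_neq0.
  rewrite mulrAC ler_pM2r ?invr_gt0//; lra.
suff : lam * (eta + eps) = eps + l by lra.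

have -> : l = eps ^+ 2 / (2 * eta + eps) by rewrite epsE mulfK ?lt0r_neq0.
by rewrite /lam; field; rewrite lt0r_neq0.
Qed.

(** Each new term is at most an increment of [ln], by [ln (1 - x) <= - x] with [x] the inverse of
    [n.+2]. *)
Lemma sum_inv_le_ln (R : realType) (n : nat) :
  \sum_(1 <= t < n.+2) (t%:R)^-1 <= 1 + ln (n.+1)%:R :> R.
Proof.
elim: n => [|n IH]; first by rewrite big_nat1 invr1 ln1 addr0.
rewrite big_nat_recr//=.
have : (n.+2%:R)^-1 <= ln n.+2%:R - ln n.+1%:R :> R.
  have n2 : (n.+2%:R : R) != 0 by rewrite pnatr_eq0.
  have -> : ln n.+1%:R = ln n.+2%:R + ln (1 - (n.+2%:R)^-1) :> R.
    rewrite -lnM ?posrE ?ltr0n// ?subr_gt0 ?invf_lt1 ?ltr0n ?ltr1n//.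
    by rewrite mulrBr mulr1 divff// [in RHS]mulrSr addrK.
  have : ln (1 - (n.+2%:R)^-1) <= - (n.+2%:R)^-1 :> R.
    by apply: le_ln1Dx; rewrite ltrN2 invf_lt1 ?ltr0n ?ltr1n.
  by move=> h; rewrite opprD addNKr lerNr.
move: IH; set a := ln _; set b := ln _; set c := _^-1; set S := \sum_(_ <= _ < _) _.
lra.
Qed.

(** * Handing out units by rank *)

Lemma unit_rank_ltE (R : realType) (T : nat) (M : instance R T)
    (b b' : 'I_(nunits M)) :
  (unit_rank b' <= unit_rank b)%N && (b' != b) = (unit_rank b' < unit_rank b)%N.
Proof.
rewrite [RHS]ltn_neqAle andbC; congr (~~ _ && _).
by rewrite /unit_rank eqSS (inj_eq val_inj) (inj_eq perm_inj).
Qed.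

(** Induction on the rank: the unit of rank [k.+1] gives the lesser of its content and what the
    earlier ranks left unserved of [a]. *)
Lemma handed_prefix (R : realType) (T : nat) (M : instance R T)
    (r : 'I_(nunits M) -> R) (a : R) (k : nat) :
  (forall b, 0 <= r b) -> 0 <= a ->
  \sum_(b < nunits M | (unit_rank b <= k)%N) handed r a b =
  Num.min a (\sum_(b < nunits M | (unit_rank b <= k)%N) r b).
Proof.
move=> r0 a0; elim: k => [|k IH].
  by rewrite !big_pred0 ?min_r// => b; rewrite /unit_rank.
have [kn|kn] := ltnP k (nunits M); last first.
  suff E (b : 'I_(nunits M)) : (unit_rank b <= k.+1)%N = (unit_rank b <= k)%N.
    by rewrite !(eq_bigl _ _ E).
  have := ltn_ord (sched M b); rewrite /unit_rank => h.
  by rewrite ltnS (leq_trans h kn) (leq_trans (ltnW h) kn).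
pose b := (sched M)^-1%g (Ordinal kn).
have rb : unit_rank b = k.+1 by rewrite /unit_rank /b permKV.
have E (b' : 'I_(nunits M)) : (unit_rank b' <= k.+1)%N && (b' != b) = (unit_rank b' <= k)%N.
  by rewrite -rb unit_rank_ltE rb ltnS.
rewrite (bigD1 b) ?rb//= [in RHS](bigD1 b) ?rb//= !(eq_bigl _ _ E) IH.
rewrite /handed rb; under [X in a - X]eq_bigl do rewrite ltnS.
set S := \sum_(_ < _ | _) _.
have S0 : 0 <= S by exact: sumr_ge0.
have := r0 b; move: (r b) => x x0.
rewrite /Num.min /Num.max; repeat case: ifPn; rewrite -?leNgt; lra.
Qed.

Lemma handed_sum (R : realType) (T : nat) (M : instance R T)
    (r : 'I_(nunits M) -> R) (a : R) :
  (forall b, 0 <= r b) -> 0 <= a <= \sum_b r b ->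
  \sum_b handed r a b = a.
Proof.
move=> r0 /andP[a0 ar].
have E (b : 'I_(nunits M)) : (unit_rank b <= nunits M)%N = true by exact: ltn_ord.
have := handed_prefix (nunits M) r0 a0.
by rewrite !(eq_bigl _ _ E) => ->; rewrite min_l.
Qed.

Lemma handed_bounds (R : realType) (T : nat) (M : instance R T)
    (r : 'I_(nunits M) -> R) (a : R) (b : 'I_(nunits M)) :
  0 <= r b -> 0 <= handed r a b <= r b.
Proof. by move=> rb; rewrite /handed le_min rb le_max lexx/= ge_min lexx. Qed.

(** If [b] is not exhausted, the demand [a] was already met by the ranks up to that of [b]. *)
Lemma handed_lt_prefix (R : realType) (T : nat) (M : instance R T)
    (r : 'I_(nunits M) -> R) (a : R) (b : 'I_(nunits M)) :
  (forall b', 0 <= r b') -> 0 <= a -> handed r a b < r b ->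
  \sum_(b' < nunits M | (unit_rank b' <= unit_rank b)%N) handed r a b' = a.
Proof.
move=> r0 a0 hb; rewrite handed_prefix// min_l//.
rewrite (bigD1 b)//= (eq_bigl _ _ (unit_rank_ltE b)); move: hb; rewrite /handed.
set S := \sum_(_ < _ | _) _.
rewrite gt_min ltxx/= gt_max => /andP[_]; lra.
Qed.

(** * Arrivals over intervals, and the state of the allocation *)

Lemma arrivals_cat (R : realType) (T : nat) (M : instance R T)
    (s t u : nat) (om : Omega M) : (s <= t.+1)%N -> (t <= u)%N ->
  arrivals s u om = arrivals s t om + arrivals t.+1 u om.
Proof. by move=> st tu; rewrite /arrivals (big_cat_nat (n := t.+1)). Qed.

Lemma arrivals_ge0 (R : realType) (T : nat) (M : instance R T)
    (s t : nat) (om : Omega M) : 0 <= arrivals s t om.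
Proof. by apply: sumr_ge0 => u _; apply: sumr_ge0 => th _; exact: ler0n. Qed.

Lemma arrivals_nil (R : realType) (T : nat) (M : instance R T)
    (s t : nat) : (t < s)%N -> @arrivals R T M s t = fun=> 0.
Proof. by move=> ts; apply/funext => om; rewrite /arrivals big_geq. Qed.

Lemma arrivals1 (R : realType) (T : nat) (M : instance R T)
    (t : nat) (om : Omega M) : arrivals t t om = \sum_(th : Theta M) narrR t th om.
Proof. by rewrite /arrivals big_nat1. Qed.

(** This is [Xalg] without its type argument, as all types receive the same amount. *)
Definition rate (R : realType) (T : nat) (M : instance R T) (delta L : R)
    (om : Omega M) (t : nat) : R :=
  guardrail delta L t om (state delta L om t.-1).1.

Definition allocated (R : realType) (T : nat) (M : instance R T) (delta L : R)
    (om : Omega M) (t : nat) : R :=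
  \sum_(1 <= s < t.+1) arrivals s s om * rate delta L om s.

(* The last clause holds because units are handed out by increasing rank: as
   long as b is not used up, everything came from units of rank at most that of
   b, each of which amounts to 1. *)
Definition consistent (R : realType) (T : nat) (M : instance R T) (delta L : R)
    (om : Omega M) (t : nat) : Prop :=
  let st := state delta L om t in
  [/\ forall b, 0 <= st.2 b <= 1,
      \sum_b st.2 b = st.1 &
      forall b, 0 < st.2 b -> allocated delta L om t +
        \sum_(b' < nunits M | (unit_rank b' <= unit_rank b)%N) st.2 b' <=
        (unit_rank b)%:R].

Lemma consistent0 (R : realType) (T : nat) (M : instance R T) (delta L : R)
    (om : Omega M) : consistent delta L om 0.
Proof.
split => /= [b||b _]; first by rewrite ler01 lexx.
  by rewrite sumr_const card_ord.
have bn : (unit_rank b <= nunits M)%N by exact: ltn_ord.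
(* Reindexed by rank, the units of rank at most [unit_rank b] are the first [unit_rank b] ordinals,
   each with content 1. *)
rewrite /allocated big_geq// add0r (reindex_inj (@perm_inj _ (sched M)^-1%g)) /=.
rewrite (eq_bigl (fun i : 'I_(nunits M) => (i < unit_rank b)%N)) => [|i].
  by rewrite (big_ord_narrow bn) sumr_const card_ord.
by rewrite {1}/unit_rank permKV.
Qed.

(** A loss of real amounts is bounded by a count of units: a unit that spoils with something left
    has rank above the total allocated, and what is left of it is at most 1. The bound of [a] by the
    budget ensures that the amounts handed out add up to [a]. *)
Lemma consistentS (R : realType) (T : nat) (M : instance R T) (delta L : R)
    (om : Omega M) (t : nat) :
  let a := arrivals t.+1 t.+1 om * rate delta L om t.+1 in
  consistent delta L om t -> 0 <= a <= (state delta L om t).1 ->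
  consistent delta L om t.+1 /\
  (state delta L om t).1 - a -
    \sum_b ((perish b om == t.+1) &&
            (allocated delta L om t.+1 < (unit_rank b)%:R))%:R <=
  (state delta L om t.+1).1.
Proof.
move=> a [r01 rE rlast] /andP[a0 aB].
have stE : state delta L om t.+1 =
    step delta L om t.+1 (state delta L om t) by [].
have aE : \sum_(th : Theta M) narrR t.+1 th om *
    guardrail delta L t.+1 om (state delta L om t).1 = a.
  by rewrite -mulr_suml -arrivals1.
rewrite /consistent stE /step /= aE; set r := (state delta L om t).2 in r01 rE rlast *.
have allocS : allocated delta L om t.+1 = allocated delta L om t + a.
  by rewrite /allocated big_nat_recr.
have r0 b : 0 <= r b by case/andP: (r01 b).
have h0 b : 0 <= handed r a b <= r b by exact: handed_bounds.
have rest01 b : 0 <= r b - handed r a b <= 1.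
  by have /andP[] := r01 b; have /andP[] := h0 b; lra.
have restlast b : 0 < r b - handed r a b ->
    allocated delta L om t.+1 +
    \sum_(b' < nunits M | (unit_rank b' <= unit_rank b)%N) (r b' - handed r a b') <=
    (unit_rank b)%:R.
  move=> rb; rewrite sumrB handed_lt_prefix//; last by rewrite -subr_gt0.
  have : 0 < r b by have /andP[] := h0 b; lra.
  by move=> /rlast; rewrite allocS; lra.
split; last first.
  rewrite lerD2l lerN2 [leLHS]big_mkcond; apply: ler_sum => b _.
  case: eqP => //= _; have [rb|rb] := ltP 0 (r b - handed r a b); last first.
    exact: le_trans rb (ler0n _ _).
  (* Strictness comes from the rest of [b] itself, a positive term of the sum in [restlast]. *)
  have -> : allocated delta L om t.+1 < (unit_rank b)%:R.
    apply: lt_le_trans (restlast b rb); rewrite ltrDl.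
    rewrite (bigD1 b)//= ltr_wpDr// sumr_ge0// => b' _.
    by case/andP: (rest01 b').
  by case/andP: (rest01 b).
split => [b||b].
- by case: ifP => _; rewrite ?lexx ?ler01//; exact: rest01.
- have aS : \sum_b handed r a b = a by rewrite handed_sum// a0 rE.
  rewrite -rE [X in _ = _ - X - _](esym aS) -sumrB.
  rewrite [X in _ = _ - X]big_mkcond -sumrB; apply: eq_bigr => b _.
  by case: eqP => _; rewrite ?subrr ?subr0.
- case: ifP => [_|_ /restlast]; first by rewrite ltxx.
  apply: le_trans; rewrite lerD2l; apply: ler_sum => b' _.
  by case: ifP => // _; case/andP: (rest01 b').
Qed.

(** * The rates chosen when the forecasts hold *)

Lemma meanN_nil (R : realType) (T : nat) (M : instance R T) (s t : nat) :
  (t < s)%N -> meanN M s t = 0.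
Proof.
by move=> ts; rewrite /meanN arrivals_nil// /mean -[fun=> 0]/(cst 0) expectation_cst.
Qed.

Lemma confN_nil (R : realType) (T : nat) (M : instance R T) (delta : R) (s t : nat) :
  (t <= s)%N -> confN M delta s t = 0.
Proof.
by move=> ts; rewrite /confN (eqP (_ : (t - s)%N == 0%N)) ?subn_eq0// mulr0 !mul0r sqrtr0.
Qed.

(* The units that can spoil in rounds t, ..., T - 1 when every rate is at least
   Xlow; what spoils at the end of round T no longer matters. *)
Definition late (R : realType) (T : nat) (M : instance R T) (delta : R)
    (om : Omega M) (t : nat) : R :=
  \sum_(b < nunits M) ((t <= perish b om < T)%N &&
    (arrivals 1 (perish b om) om * Xlow M delta < (unit_rank b)%:R))%:R.

Definition at_risk (R : realType) (T : nat) (M : instance R T) (delta : R)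
    (t : nat) (b : 'I_(nunits M)) : set (Omega M) :=
  [set om | (t <= perish b om)%N] `&` perish_before delta t (Xlow M delta) b.

(** The random count whose mean is [eta]. *)
Definition risk (R : realType) (T : nat) (M : instance R T) (delta : R)
    (om : Omega M) (t : nat) : R :=
  \sum_(b < nunits M |
      Num.ceil (Nlow M delta 1 t.-1 * Xlow M delta) <= (unit_rank b)%:Z)
    (`[< at_risk delta t b om >])%:R.

Definition good_arrivals (R : realType) (T : nat) (M : instance R T) (delta : R)
    (om : Omega M) : Prop :=
  forall s t, (1 <= s)%N -> (t <= T)%N ->
    `|arrivals s t om - meanN M s t| <= confN M delta s.-1 t.

Definition good_perish (R : realType) (T : nat) (M : instance R T) (delta : R)
    (om : Omega M) : Prop :=
  forall t, (1 <= t <= T)%N ->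
    risk delta om t <= Defs.eta M delta t + confP T delta t (Defs.eta M delta t).

Lemma Nlow_le_arrivals (R : realType) (T : nat) (M : instance R T) (delta : R)
    (om : Omega M) (s t : nat) : good_arrivals delta om -> (1 <= s)%N -> (t <= T)%N ->
  Nlow M delta s t <= arrivals s t om.
Proof. by move=> gN s1 tT; have := gN s t s1 tT; rewrite ler_norml /Nlow; lra. Qed.

Lemma arrivals_le_Nup_after (R : realType) (T : nat) (M : instance R T) (delta : R)
    (om : Omega M) (t : nat) : good_arrivals delta om ->
  arrivals t.+1 T om <= Nup_after M delta t.
Proof.
by move=> gN; have := gN t.+1 T isT (leqnn T); rewrite ler_norml /Nup_after /=; lra.
Qed.

Lemma arrivals_le (R : realType) (T : nat) (M : instance R T) (om : Omega M)
    (s t u : nat) : (s <= t.+1)%N -> (t <= u)%N -> arrivals s t om <= arrivals s u om.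
Proof. by move=> st tu; rewrite (arrivals_cat _ st tu) lerDl arrivals_ge0. Qed.

(** A unit counted in [late] has rank above arrivals times [Xlow], hence above the lower forecasts
    times [Xlow]: it passes the rank filter, and no round up to its perishing time meets the
    condition that defines [tau]. *)
Lemma late_le_risk (R : realType) (T : nat) (M : instance R T) (delta : R)
    (om : Omega M) (t : nat) :
  good_arrivals delta om -> 0 <= Xlow M delta -> (1 <= t <= T)%N ->
  late delta om t <= risk delta om t.
Proof.
move=> gN X0 /andP[t1 tT]; rewrite /late /risk [leRHS]big_mkcond.
apply: ler_sum => b _; case: ifPn; last first.
  move=> /negP nceil; case: andP => // -[/andP[tp pT] Nb]; exfalso; apply: nceil.
  rewrite ceil_le_int; apply: le_trans (ltW Nb).
  rewrite ler_wpM2r// (le_trans (Nlow_le_arrivals gN _ _))//.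
    by rewrite (leq_trans (leq_pred _)).
  by apply: arrivals_le => //; rewrite (leq_trans (leq_pred _)).
move=> _; case: andP => [[/andP[tp pT] Nb]|_]; last exact: ler0n.
suff -> : `[< at_risk delta t b om >] by [].
apply/asboolP; split => //; rewrite /perish_before /= lt_min lte_fin ltr_nat pT/=.
rewrite ltNge; apply/negP => taup.
(* An infimum below [(perish b om).+1] provides an actual round [t'] in the set, and [t'] is at most
   [perish b om] by integrality. *)
have /ereal_inf_lt[_ [t' [/andP[tt' t'T] rt'] <-]] :
    (tau delta t (Xlow M delta) b < ((perish b om).+1%:R)%:E)%E.
  by apply: le_lt_trans taup _; rewrite lte_fin ltr_nat.
rewrite lte_fin ltr_nat ltnS => t'p.
suff : (unit_rank b)%:R <= arrivals 1 (perish b om) om * Xlow M delta.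
  by rewrite leNgt Nb.
apply: le_trans rt' _; rewrite -mulrDl ler_wpM2r//.
apply: le_trans (arrivals_le om _ t'p); last by [].
have t1t' : (t.-1 <= t')%N by exact: leq_trans (leq_pred t) tt'.
rewrite (arrivals_cat om _ t1t')// prednK// lerD//; apply: Nlow_le_arrivals => //.
exact: leq_trans (leq_pred t) tT.
Qed.

Lemma late_ge0 (R : realType) (T : nat) (M : instance R T) (delta : R)
    (om : Omega M) (t : nat) : 0 <= late delta om t.
Proof. by apply: sumr_ge0 => b _; exact: ler0n. Qed.

Lemma late_le_nunits (R : realType) (T : nat) (M : instance R T) (delta : R)
    (om : Omega M) (t : nat) : late delta om t <= (nunits M)%:R.
Proof.
rewrite -[X in X%:R]card_ord -sumr_const; apply: ler_sum => b _.
by rewrite lern1 leq_b1.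
Qed.

Lemma late_decr (R : realType) (T : nat) (M : instance R T) (delta : R)
    (om : Omega M) (t : nat) : late delta om t.+1 <= late delta om t.
Proof.
apply: ler_sum => b _; rewrite ler_nat.
case: (ltnP t (perish b om)) => [tp|//]; by rewrite (ltnW tp).
Qed.

(** As [late] is nonincreasing in [t], an earlier bound stays valid, which matches the running
    minimum in [Pup]. *)
Lemma late_le_Pup (R : realType) (T : nat) (M : instance R T) (delta : R)
    (om : Omega M) (t : nat) :
  good_arrivals delta om -> good_perish delta om -> 0 <= Xlow M delta ->
  (t <= T)%N -> late delta om t <= Pup M delta t.
Proof.
move=> gN gP X0; elim: t => [_|t IH tT]; first exact: late_le_nunits.
rewrite /= le_min (le_trans (late_decr _ _ _)) ?IH ?(ltnW tT)//=.
by rewrite (le_trans (late_le_risk _ _ _)) ?gP.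
Qed.

(** In round 1 the rank filter is vacuous, since [Nlow M delta 1 0] is 0, and all perishing times
    are at least 1. Hence the forecast of round 1 also controls [Delta_bar], without a further
    failure event. *)
Lemma eta1 (R : realType) (T : nat) (M : instance R T) (delta : R) :
  admissible M -> Defs.eta M delta 1 = mu_perish M delta (Xlow M delta).
Proof.
move=> adm; rewrite /Defs.eta /mu_perish; apply: eq_big => b.
  by rewrite /= /Nlow meanN_nil// confN_nil// subr0 mul0r ceil0.
move=> _; congr (fine (Pr M _)); apply/seteqP; split => [om []//|om ?]; split => //.
exact: (perish_ge1 adm).
Qed.

Lemma late_le_Delta_bar (R : realType) (T : nat) (M : instance R T) (delta : R)
    (om : Omega M) :
  admissible M -> (0 < T)%N ->
  good_arrivals delta om -> good_perish delta om -> 0 <= Xlow M delta ->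
  late delta om 1 <= Delta_bar M delta (Xlow M delta).
Proof.
move=> adm T0 gN gP X0; rewrite /Delta_bar le_min late_le_nunits/= -eta1//.
by rewrite (le_trans (late_le_risk _ _ _)) ?gP.
Qed.

(* [late delta om t] bounds what can still spoil before the horizon, so the
   budget invariant is [N_{>t} Xlow + late (t+1) <= B_{t+1}]: the generous rate is
   only chosen when the right amount is left, and the lean rate spends exactly
   what the invariant reserves. *)
Lemma rate_low_or_high (R : realType) (T : nat) (M : instance R T)
    (delta L : R) (om : Omega M) :
  admissible M -> 0 <= L -> 0 < Nup M delta ->
  feasible_rates M delta (Xlow M delta) ->
  good_arrivals delta om -> good_perish delta om ->
  forall t, (t < T)%N ->
    (rate delta L om t.+1 = Xlow M delta \/
     rate delta L om t.+1 = Xlow M delta + L).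
Proof.
move=> adm L0 Nup0 [X0 Xfeas] gN gP; set X := Xlow M delta in X0 Xfeas *.
pose inv t := [/\ consistent delta L om t,
  arrivals 1 t om * X <= allocated delta L om t &
  arrivals t.+1 T om * X + late delta om t.+1 <= (state delta L om t).1].
have inv_rate t : (t < T)%N -> inv t ->
    let a := arrivals t.+1 t.+1 om * rate delta L om t.+1 in
    [/\ rate delta L om t.+1 = X \/ rate delta L om t.+1 = X + L,
        a <= (state delta L om t).1 &
        arrivals t.+2 T om * X + late delta om t.+1 <= (state delta L om t).1 - a].
  move=> tT [_ _ Binv] a.
  have Ncat : arrivals t.+1 T om = arrivals t.+1 t.+1 om + arrivals t.+2 T om.
    exact: arrivals_cat.
  have N2 : 0 <= arrivals t.+2 T om * X by rewrite mulr_ge0 ?arrivals_ge0.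
  have l0 := late_ge0 delta om t.+1.
  move: Binv; rewrite Ncat mulrDl => Binv.
  (* The invariant pays for this round at rate [X], so the branch that spends the whole budget is
     excluded. *)
  rewrite /a /rate [t.+1.-1]/= /guardrail -/X ifN; last by rewrite -leNgt; lra.
  case: ifP => [Bup|_]; last by split; [left| |]; lra.
  (* The test for the higher rate reserves upper forecasts of arrivals and losses, which dominate
     the true needs. *)
  have lP := late_le_Pup gN gP X0 tT.
  have NP : arrivals t.+2 T om * X <= X * Nup_after M delta t.+1.
    by rewrite mulrC ler_wpM2l// arrivals_le_Nup_after.
  by split; [right| |]; lra.
have invT t : (t < T)%N -> inv t.
  elim: t => [T0|t IH tT].
    split; first exact: consistent0.
      by rewrite arrivals_nil// mul0r /allocated big_geq.
    (* Initially the inequality defining feasibility of [Xlow] is the invariant with [Nup] and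
       [Delta_bar] in place of arrivals and losses. *)
    have lD := late_le_Delta_bar adm T0 gN gP X0.
    have NN := arrivals_le_Nup_after 0 gN.
    have : X * Nup M delta <= (nunits M)%:R - Delta_bar M delta X.
      by rewrite -ler_pdivlMr.
    have : arrivals 1 T om * X <= X * Nup M delta.
      by rewrite mulrC ler_wpM2l.
    move: lD; rewrite -/X /=; lra.
  have it := IH (ltnW tT); have [rt aB Bt] := inv_rate t (ltnW tT) it.
  have [ct At Binv] := it.
  have Xr : X <= rate delta L om t.+1 by case: rt => ->; lra.
  have a0 : 0 <= arrivals t.+1 t.+1 om * rate delta L om t.+1.
    by rewrite mulr_ge0 ?arrivals_ge0// (le_trans X0).
  have [cS stS] := consistentS ct (introT andP (conj a0 aB)).
  have AS : arrivals 1 t.+1 om * X <= allocated delta L om t.+1.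
    rewrite (arrivals_cat om (s := 1%N) (t := t))// mulrDl /allocated big_nat_recr//=.
    by rewrite lerD// ler_wpM2l ?arrivals_ge0.
  split => //; apply: le_trans stS.
  set pua := \sum_(_ < _) _.
  (* A unit counted in [pua] drops out of [late] after round [t.+1]; it was counted before because
     [t.+1 < T] and its rank exceeds the total allocated, which is at least arrivals times [X]. *)
  suff : late delta om t.+2 + pua <= late delta om t.+1 by lra.
  rewrite -big_split; apply: ler_sum => b _ /=.
  case: (ltngtP t.+1 (perish b om)) => [tp|tp|tp] /=; rewrite ?addr0//.
  rewrite -tp tT /= add0r ler_nat.
  by case: (ltP (allocated _ _ _ _)) => // /(le_lt_trans AS) ->.
by move=> t tT; have [] := inv_rate t tT (invT t tT).
Qed.

(** * Envy and inefficiency when the forecasts hold *)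

Lemma arrivals_ge_T (R : realType) (T : nat) (M : instance R T) (om : Omega M) :
  (0 < #|Theta M|)%N ->
  (forall t (th : Theta M), (1 <= t <= T)%N -> (1 <= narr t th om)%N) ->
  T%:R <= arrivals 1 T om.
Proof.
move=> /card_gt0P[th0 _] N1; rewrite /arrivals big_nat.
apply: (@le_trans _ _ (\sum_(1 <= t < T.+1 | (1 <= t < T.+1)%N) 1)).
  by rewrite -big_nat sumr_const_nat subn1.
apply: ler_sum => t tT; rewrite (bigD1 th0)//= ler_wpDr//.
  by apply: sumr_ge0 => th _; exact: ler0n.
by rewrite /narrR ler1n N1.
Qed.

Lemma Lperish_ge0 (R : realType) (T : nat) (M : instance R T) (delta : R) :
  0 < Nup M delta -> 0 <= Delta_bar M delta (Xlow M delta) ->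
  feasible_rates M delta (Xlow M delta) -> 0 <= Lperish M delta.
Proof.
move=> Nup0 D0 [_ Xf]; rewrite /Lperish subr_ge0; apply: le_trans Xf _.
by rewrite ler_pM2r ?invr_gt0// gerBl.
Qed.

(** The difference factors as [B / (e + conf) * ((N - (e + conf)) / N)], and [N] is within
    [2 * conf] of [e + conf]. *)
Lemma forecast_ratio_gap (R : realFieldType) (B e conf N : R) :
  0 <= B -> 0 < e -> 0 <= conf -> 0 < N -> `|N - e| <= conf ->
  `|B / (e + conf) - B / N| <= 2 * (B / e) * conf / N.
Proof.
move=> B0 e0 c0 N0 Ne; have ec : 0 < e + conf by lra.
have -> : B / (e + conf) - B / N = B / (e + conf) * ((N - (e + conf)) / N).
  by field; rewrite !lt0r_neq0.
have NE : `|N - (e + conf)| <= 2 * conf.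
  by move: Ne; rewrite !ler_norml; lra.
rewrite !normrM !normfV (gtr0_norm ec) (gtr0_norm N0) (ger0_norm B0).
have Be : B / (e + conf) <= B / e by rewrite ler_wpM2l// lef_pV2 ?posrE// lerDl.
rewrite mulrA ler_pM2r ?invr_gt0//.
have -> : 2 * (B / e) * conf = B / e * (2 * conf) by ring.
by apply: ler_pM => //; rewrite divr_ge0 ?(ltW ec).
Qed.

Lemma Delta_EF_bound (R : realType) (T : nat) (M : instance R T) (delta L : R)
    (om : Omega M) :
  let N := arrivals 1 T om in
  0 <= L -> (forall th : Theta M, 0 < weight th) -> 0 < meanN M 1 T -> 0 < T%:R :> R ->
  T%:R <= N -> `|N - meanN M 1 T| <= confN M delta 0 T ->
  0 <= Lperish M delta ->
  (forall t, (t < T)%N -> rate delta L om t.+1 = Xlow M delta \/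
     rate delta L om t.+1 = Xlow M delta + L) ->
  Delta_EF delta L om <= w_max M *
    (Lperish M delta + L + 2 * beta_avg M * confN M delta 0 T / T%:R).
Proof.
move=> N L0 w0 e0 T0 NT Ne Lp0 Xrate.
have c0 : 0 <= confN M delta 0 T by exact: sqrtr_ge0.
have beta0 : 0 <= beta_avg M by rewrite divr_ge0 ?ler0n ?(ltW e0).
have gap : `|(nunits M)%:R / Nup M delta - (nunits M)%:R / N| <=
    2 * beta_avg M * confN M delta 0 T / T%:R.
  apply: le_trans (forecast_ratio_gap _ e0 c0 _ Ne) _ => //.
    exact: lt_le_trans NT.
  apply: ler_wpM2l; first exact: (mulr_ge0 (mulr_ge0 (ler0n R 2) beta0) c0).
  by rewrite lef_pV2 ?posrE// (lt_le_trans T0).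
set D := Lperish M delta + L + _.
have D0 : 0 <= D.
  exact: (addr_ge0 (addr_ge0 Lp0 L0)
    (divr_ge0 (mulr_ge0 (mulr_ge0 (ler0n R 2) beta0) c0) (ltW T0))).
have wmax0 : 0 <= w_max M by exact: bigmax_ge_id.
rewrite /Delta_EF big_nat; apply: bigmax_le => [|t /andP[t1 tT]].
  by rewrite mulr_ge0.
apply: bigmax_le => [|th _]; first by rewrite mulr_ge0.
rewrite normrM (gtr0_norm (w0 th)); apply: ler_pM => //; first exact/ltW/w0.
  exact: (le_bigmax _ (@weight _ _ M) th).
case: t t1 tT => // t _ tT; have := Xrate t tT.
rewrite /rate /Xalg; set x := guardrail _ _ _ _ _ => xE.
have -> : x - (nunits M)%:R / N = (x - Xlow M delta) - Lperish M delta +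
    ((nunits M)%:R / Nup M delta - (nunits M)%:R / N).
  by rewrite /Lperish; lra.
move: gap; rewrite /D !ler_norml.
by case: xE => ->; lra.
Qed.

Lemma Delta_eff_bound (R : realType) (T : nat) (M : instance R T) (delta L : R)
    (om : Omega M) :
  let N := arrivals 1 T om in
  0 <= L -> 0 < meanN M 1 T -> `|N - meanN M 1 T| <= confN M delta 0 T ->
  0 <= Lperish M delta ->
  (forall t, (t < T)%N -> rate delta L om t.+1 = Xlow M delta \/
     rate delta L om t.+1 = Xlow M delta + L) ->
  Delta_eff delta L om <= 2 * beta_avg M * confN M delta 0 T +
    Nup M delta * Lperish M delta.
Proof.
move=> N L0 e0 Ne Lp0 Xrate.
have c0 : 0 <= confN M delta 0 T by exact: sqrtr_ge0.
have Nup0 : 0 < Nup M delta by rewrite /Nup; lra.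
have NX : N * Xlow M delta <=
    \sum_(1 <= t < T.+1) \sum_(th : Theta M) narrR t th om * Xalg delta L t th om.
  rewrite /N /arrivals mulr_suml big_nat [leRHS]big_nat; apply: ler_sum => t /andP[t1 tT].
  rewrite mulr_suml; apply: ler_sum => th _; rewrite ler_wpM2l ?ler0n//.
  case: t t1 tT => // t _ tT; have := Xrate t tT.
  by rewrite /rate /Xalg => -[] ->; lra.
rewrite /Delta_eff; apply: (@le_trans _ _ ((nunits M)%:R - N * Xlow M delta)).
  by rewrite lerD2l lerN2.
(* The waste splits into the error in forecasting [N], weighted by the rate [B / Nup], and [N] times
   the rate lost to perishing. *)
have -> : (nunits M)%:R - N * Xlow M delta =
    (nunits M)%:R / Nup M delta * (Nup M delta - N) + N * Lperish M delta.
  by rewrite /Lperish; field; rewrite lt0r_neq0.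
apply: lerD; last by apply: ler_wpM2r => //; move: Ne; rewrite ler_norml /Nup; lra.
have -> : 2 * beta_avg M * confN M delta 0 T = beta_avg M * (2 * confN M delta 0 T) by ring.
have dN : 0 <= Nup M delta - N <= 2 * confN M delta 0 T.
  by move: Ne; rewrite ler_norml /Nup; lra.
have /andP[d0 d1] := dN; apply: ler_pM => //; first by rewrite divr_ge0 ?(ltW Nup0).
by rewrite ler_wpM2l// lef_pV2 ?posrE// /Nup lerDl.
Qed.

(** A polynomial bound for [confN] over the square root of [T]: only polynomial factors are allowed,
    so the root of [y] is replaced by [1 + y], and [ln 2] by 1. *)
Definition confN_rate (R : realType) (T : nat) (M : instance R T) (delta : R) : R :=
  rho_max M * (1 + 2 * #|Theta M|%:R * (1 + 2 * ln T%:R + ln delta^-1)).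

Lemma rho_max_ge0 (R : realType) (T : nat) (M : instance R T) : 0 <= rho_max M.
Proof. exact: bigmax_ge_id. Qed.

Lemma confN_le (R : realType) (T : nat) (M : instance R T) (delta : R) :
  (0 < T)%N -> 0 < delta < 1 ->
  confN M delta 0 T <= Num.sqrt T%:R * confN_rate M delta.
Proof.
move=> T0 /andP[d0 d1]; have r0 := rho_max_ge0 M.
have T1 : 1 <= T%:R :> R by rewrite ler1n.
have lnE : ln (2 * T%:R ^+ 2 / delta) = ln 2 + 2 * ln T%:R + ln delta^-1 :> R.
  rewrite lnM ?posrE ?invr_gt0 ?mulr_gt0 ?exprn_gt0 ?ltr0n//.
  by rewrite lnM ?posrE ?exprn_gt0 ?ltr0n// lnXn ?ltr0n// mulr_natl.
have ln2 : 0 <= ln (2 : R) <= 1.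
  rewrite ln_ge0 ?ler1n//=; have := @le_ln1Dx R 1; rewrite -[1 + 1]/(2 : R).
  by apply; lra.
have lnT : 0 <= ln T%:R :> R by rewrite ln_ge0.
have lnd : 0 <= ln delta^-1 by rewrite ln_ge0// invf_ge1// ltW.
rewrite /confN lnE subn0.
set l := ln 2 + _ + _; set c := #|Theta M|%:R.
have c0 : 0 <= c by exact: ler0n.
have l0 : 0 <= l by rewrite /l; lra.
have -> : 2 * T%:R * c * rho_max M ^+ 2 * l = T%:R * (rho_max M ^+ 2 * (2 * c * l)) by ring.
rewrite sqrtrM ?ler0n// ler_wpM2l ?sqrtr_ge0// sqrtrM ?sqr_ge0// sqrtr_sqr ger0_norm//.
rewrite /confN_rate ler_wpM2l//.
have cl0 : 0 <= 2 * c * l by rewrite !mulr_ge0.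
apply: (@le_trans _ _ (1 + 2 * c * l)).
  rewrite -[leRHS]ger0_norm; last by lra.
  by rewrite -sqrtr_sqr ler_wsqrtr// sqrrD; nra.
by rewrite lerD2l ler_wpM2l ?mulr_ge0// /l; lra.
Qed.

(** * The forecasts hold with high probability *)

Lemma narr_bounded (R : realType) (T : nat) (M : instance R T) (t : nat) (th : Theta M) :
  admissible M -> (1 <= t <= T)%N ->
  exists m : nat, \forall om \ae Pr M, (narr t th om <= m)%N.
Proof.
move=> adm tT; have := narr_bound adm th tT.
set mu := mean _; set rh := rho t th => nb.
exists (Num.bound (`|mu| + `|rh|)); move: nb; apply: filterS => om /= nb.
rewrite -(ler_nat R); apply: ltW.
apply: le_lt_trans (archi_boundP (addr_ge0 (normr_ge0 _) (normr_ge0 _))).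
rewrite -[leLHS]normr_nat -[X in `|X|](subrK mu) addrC.
by apply: (le_trans (ler_normD _ _)); rewrite lerD2l (le_trans nb)// ler_norm.
Qed.

(** Since [mean] is taken through [fine], the expectation has to be finite; almost sure boundedness
    gives this. *)
Lemma expectation_narr (R : realType) (T : nat) (M : instance R T) (t : nat) (th : Theta M) :
  admissible M -> (1 <= t <= T)%N ->
  'E_(Pr M)[narrR t th]%E = (mean (narrR t th))%:E.
Proof.
move=> adm /(narr_bounded th adm)[m nm].
by rewrite /mean /narrR (bounded_expectation nm).
Qed.

Lemma meanN_sum (R : realType) (T : nat) (M : instance R T) (s t : nat) :
  admissible M -> (1 <= s)%N -> (t <= T)%N ->
  meanN M s t = \sum_(s <= u < t.+1) \sum_(th : Theta M) mean (narrR u th).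
Proof.
move=> adm s1 tT.
have arrE om : (arrivals s t om)%:E =
    (\sum_(s <= u < t.+1) \sum_(th : Theta M) (narrR u th om)%:E)%E.
  by rewrite /arrivals -sumEFin; apply: eq_bigr => u _; rewrite sumEFin.
rewrite {1}/meanN {1}/mean unlock; under eq_integral do rewrite arrE.
have mnarr u (th : Theta M) : measurable_fun setT (EFin \o narrR u th).
  exact: (RVnat_comp_measurable (narr u th) (fun n => n%:R)).
rewrite ge0_integral_sum//; last 2 first.
- by move=> u; apply: emeasurable_sum => th; exact: mnarr.
- by move=> u om _; apply: sume_ge0 => th _; rewrite lee_fin ler0n.
rewrite big_nat [in RHS]big_nat (eq_bigr (fun u => (\sum_(th : Theta M) mean (narrR u th))%:E)).
  by rewrite sumEFin.
move=> u /andP[su ut]; rewrite ge0_integral_sum//; last 2 first.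
- by move=> th; exact: mnarr.
- by move=> th om _; rewrite lee_fin ler0n.
rewrite -sumEFin; apply: eq_bigr => th _.
rewrite -expectation_narr//; first by rewrite unlock.
by rewrite (leq_trans s1 su); exact: (@leq_trans t).
Qed.

(** The rounds from [s] to [t] as a set of indices of [primitives], to serve as [J] in
    [hoeffding_tail]; the ordinal [i] stands for round [i.+1]. *)
Definition window (R : realType) (T : nat) (M : instance R T) (s t : nat) :
    {set 'I_T * Theta M + 'I_(nunits M)} :=
  [set k : 'I_T * Theta M + 'I_(nunits M) |
    if k is inl (i, _) then (s <= i.+1 <= t)%N else false]%SET.

Lemma sum_window (R : realType) (T : nat) (M : instance R T) (V : nmodType)
    (s t : nat) (F : nat -> Theta M -> V) (G : 'I_T * Theta M + 'I_(nunits M) -> V) :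
  (1 <= s)%N -> (t <= T)%N -> (forall i th, G (inl (i, th)) = F i.+1 th) ->
  \sum_(k in window M s t) G k = \sum_(s <= u < t.+1) \sum_(th : Theta M) F u th.
Proof.
move=> s1 tT GF; rewrite big_sumType/= [X in _ + X]big_pred0 ?addr0; last first.
  by move=> b; rewrite inE.
rewrite (eq_bigl (fun p : 'I_T * Theta M => (s <= p.1.+1 <= t)%N && true)); last first.
  by move=> [i th]; rewrite inE andbT.
rewrite (eq_bigr (fun p : 'I_T * Theta M => F p.1.+1 p.2)); last by case=> i th _; rewrite GF.
rewrite -(pair_big (fun i : 'I_T => (s <= i.+1 <= t)%N) xpredT (fun i th => F i.+1 th))/=.
rewrite (@big_nat_widenl _ _ _ s 1)// (@big_nat_widen _ _ _ 1 t.+1 T.+1)//.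
rewrite big_add1/= big_mkord; apply: eq_bigl => i.
by rewrite !ltnS.
Qed.

Lemma card_window (R : realType) (T : nat) (M : instance R T) (s t : nat) :
  (1 <= s)%N -> (t <= T)%N ->
  #|window M s t|%:R = (t - s.-1)%:R * #|Theta M|%:R :> R.
Proof.
move=> s1 tT; rewrite -sumr_const (sum_window (F := fun _ _ => 1))//.
under eq_bigr do rewrite sumr_const.
by rewrite sumr_const_nat -{1}(prednK s1) subSS mulrC mulr_natr.
Qed.

Lemma rho_le_max (R : realType) (T : nat) (M : instance R T) (t : nat) (th : Theta M) :
  (1 <= t <= T)%N -> rho t th <= rho_max M.
Proof.
move=> tT; apply: (@le_trans _ _ (\big[Num.max/0]_(th : Theta M) rho t th)).
  exact: le_bigmax.
by apply: (@le_bigmax_seq _ _ _ _ _ t); rewrite ?mem_index_iota.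
Qed.

Lemma prob_arrivals_deviation (R : realType) (T : nat) (M : instance R T) (delta sg : R)
    (s t : nat) :
  admissible M -> 0 < delta < 1 -> (1 <= s <= T)%N -> (t <= T)%N -> `|sg| = 1 ->
  (Pr M [set om | (confN M delta s.-1 t < sg * (arrivals s t om - meanN M s t))%R] <=
   (delta / (2 * T%:R ^+ 2))%:E)%E.
Proof.
move=> adm /andP[d0 d1] /andP[s1 sT] tT sg1.
have T1 : 1 <= T%:R :> R by rewrite ler1n (leq_trans s1).
(* Its logarithm [l] is thus nonnegative, and [expR (- l)] is exactly [delta / (2 * T%:R ^+ 2)]. *)
have x1 : 1 <= 2 * T%:R ^+ 2 / delta.
  rewrite ler_pdivlMr// mul1r (le_trans (ltW d1))//.
  by rewrite mulr_ege1// ?ler1n// expr_ge1.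
pose mu (k : 'I_T * Theta M + 'I_(nunits M)) : R :=
  if k is inl (i, th) then mean (narrR i.+1 th) else 0.
have iT (i : 'I_T) : (1 <= i.+1 <= T)%N by rewrite /= ltn_ord.
have := hoeffding_tail (J := window M s t) (mu := mu) (s := sg)
  (rho := rho_max M) (l := ln (2 * T%:R ^+ 2 / delta))
  (primitives_indep adm) (rho_max_ge0 M) (ln_ge0 x1) sg1.
rewrite expRN lnK ?posrE ?(lt_le_trans ltr01 x1)// invf_div card_window// => H.
have E om : \sum_(k in window M s t) ((primitives k om)%:R - mu k) =
    arrivals s t om - meanN M s t.
  rewrite meanN_sum// /arrivals -sumrB.
  rewrite (sum_window (F := fun u th => narrR u th om - mean (narrR u th)))//.
  by apply: eq_bigr => u _; rewrite sumrB.
move: H; under eq_set do rewrite E.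
rewrite /confN mulrA; apply.
- by move=> [[i th]|b]; rewrite inE//= => _; exact: expectation_narr.
- move=> [[i th]|b]; rewrite inE//= => _; move: (narr_bound adm th (iT i)).
  by apply: filterS => om /le_trans; apply; exact: rho_le_max.
Qed.

(** With [determined_measurable], dependence on the primitives alone replaces direct measurability
    proofs. The primitives cover the rounds 1 to [T], whence the bounds on [s] and [t]. *)
Lemma arrivals_det (R : realType) (T : nat) (M : instance R T) (om om' : Omega M)
    (s t : nat) : (forall k, primitives k om = primitives k om') ->
  (1 <= s)%N -> (t <= T)%N -> arrivals s t om = arrivals s t om'.
Proof.
move=> eqp s1 tT; apply: eq_big_nat => u /andP[su ut]; apply: eq_bigr => th _.
have uT : (u.-1 < T)%N by rewrite prednK ?(leq_trans s1 su)// (leq_trans _ tT).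
have := eqp (inl (Ordinal uT, th)); rewrite /= prednK ?(leq_trans s1 su)//.
by rewrite /narrR => ->.
Qed.

Lemma perish_det (R : realType) (T : nat) (M : instance R T) (om om' : Omega M)
    (b : 'I_(nunits M)) : (forall k, primitives k om = primitives k om') ->
  perish b om = perish b om'.
Proof. by move=> /(_ (inr b)). Qed.

Lemma measurable_primitives (R : realType) (T : nat) (M : instance R T)
    (E : set (Omega M)) :
  (forall om om', (forall k, primitives k om = primitives k om') -> E om -> E om') ->
  measurable E.
Proof. exact: determined_measurable. Qed.

Lemma good_arrivals_det (R : realType) (T : nat) (M : instance R T) (delta : R)
    (om om' : Omega M) : (forall k, primitives k om = primitives k om') ->
  good_arrivals delta om -> good_arrivals delta om'.
Proof.
move=> eqp gN s t s1 tT.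
by rewrite -(arrivals_det eqp)//; exact: gN.
Qed.

Lemma risk_det (R : realType) (T : nat) (M : instance R T) (delta : R)
    (om om' : Omega M) (t : nat) : (forall k, primitives k om = primitives k om') ->
  risk delta om t = risk delta om' t.
Proof.
move=> eqp; apply: eq_bigr => b _; congr (nat_of_bool _)%:R.
by apply: asbool_equiv_eq; rewrite /at_risk /perish_before /= (perish_det b eqp).
Qed.

Lemma good_perish_det (R : realType) (T : nat) (M : instance R T) (delta : R)
    (om om' : Omega M) : (forall k, primitives k om = primitives k om') ->
  good_perish delta om -> good_perish delta om'.
Proof. by move=> eqp gP t tT; rewrite -(risk_det _ _ eqp); exact: gP. Qed.

Lemma prob_bad_arrivals (R : realType) (T : nat) (M : instance R T) (delta : R) :
  admissible M -> 0 < delta < 1 -> (0 < T)%N ->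
  (Pr M (~` [set om | good_arrivals delta om]) <= delta%:E)%E.
Proof.
move=> adm d01 T0.
pose A (p : 'I_T * 'I_T * bool) : set (Omega M) := [set om |
  confN M delta p.1.1 p.1.2.+1 < (-1) ^+ p.2 *
    (arrivals p.1.1.+1 p.1.2.+1 om - meanN M p.1.1.+1 p.1.2.+1)].
apply: (@le_trans _ _ (\sum_p Pr M (A p))%E).
  apply: finite_union_bound => [p||om /= ngN].
  - apply: measurable_primitives => om om' eqp; rewrite /A /=.
    by rewrite (arrivals_det eqp).
  - apply: measurableC; apply: measurable_primitives => om om' eqp.
    exact: good_arrivals_det.
  apply: contrapT => nA; apply: ngN => s t s1 tT.
  (* Intervals with [t < s] deviate by 0; the others have their ends in the range indexed by [A]. *)
  case: t tT => [_|t tT]; first by rewrite arrivals_nil// meanN_nil// subrr normr0 sqrtr_ge0.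
  have [sT|sT] := leqP s T; last first.
    have ts : (t.+1 < s)%N by exact: leq_ltn_trans sT.
    by rewrite arrivals_nil// meanN_nil// subrr normr0 sqrtr_ge0.
  case: s s1 sT => // s _ sT; rewrite leNgt; apply/negP => dev; apply: nA.
  set x := arrivals _ _ _ - _ in dev.
  exists (Ordinal sT, Ordinal tT, x < 0) => //; rewrite /A /= -/x.
  have [x0|x0] := ltP x 0; first by rewrite expr1 mulN1r -ltr0_norm.
  by rewrite expr0 mul1r -(ger0_norm x0).
apply: (@le_trans _ _ (\sum_(p : 'I_T * 'I_T * bool) (delta / (2 * T%:R ^+ 2))%:E)%E).
  apply: lee_sum => -[[i j] sg] _; rewrite /A /=.
  have iT : (1 <= i.+1 <= T)%N by rewrite /= ltn_ord.
  exact: (prob_arrivals_deviation adm d01 iT (ltn_ord j) (normr_sign R sg)).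
rewrite sumEFin sumr_const !card_prod !card_ord card_bool lee_fin.
rewrite -[leLHS]mulr_natl !natrM.
have T0' : T%:R != 0 :> R by rewrite pnatr_eq0 -lt0n.
by rewrite le_eqVlt; apply/orP; left; apply/eqP; field.
Qed.

(** As [tau] is deterministic, being at risk is a condition on the perishing time alone, so [risk]
    is a sum of independent indicators. [1 <= ln T] makes the logarithm in [confP] nonnegative. *)
Lemma prob_risk_tail (R : realType) (T : nat) (M : instance R T) (delta : R) (t : nat) :
  admissible M -> 0 < delta < 1 -> 1 <= ln (T%:R : R) -> (1 <= t <= T)%N ->
  (Pr M [set om | (Defs.eta M delta t + confP T delta t (Defs.eta M delta t) <
                   risk delta om t)%R] <=
   (delta / (3 * t%:R * ln T%:R))%:E)%E.
Proof.
move=> adm /andP[d0 d1] lnT /andP[t1 tT].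
pose c (b : 'I_(nunits M)) :=
  Num.ceil (Nlow M delta 1 t.-1 * Xlow M delta) <= (unit_rank b)%:Z.
(* Arrivals and units outside the rank filter get the empty set and add 0 to both mean and count. *)
pose A (k : 'I_T * Theta M + 'I_(nunits M)) : set nat :=
  if k is inr b then if c b then [set n : nat | (t <= n)%N /\
      ((n%:R)%:E < Order.min (T%:R)%:E (tau delta t (Xlow M delta) b))%E]
    else set0 else set0.
have t0 : 0 < t%:R :> R by rewrite ltr0n.
have t1' : 1 <= t%:R :> R by rewrite ler1n.
have x1 : 1 <= 3 * t%:R * ln (T%:R : R) / delta.
  rewrite ler_pdivlMr// mul1r (le_trans (ltW d1))//.
  by rewrite mulr_ege1// mulr_ege1// ler1n.
have x0 := lt_le_trans ltr01 x1.
have := chernoff_tail A (primitives_indep adm) (ln_ge0 x1).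
rewrite expRN lnK ?posrE// invf_div.
have -> : \sum_k fine (Pr M (primitives k @^-1` A k)) = Defs.eta M delta t.
  rewrite big_sumType/= big1 ?add0r; last by move=> p _; rewrite preimage_set0 measure0.
  rewrite /Defs.eta [RHS]big_mkcond/=; apply: eq_bigr => b _.
  by rewrite /A /c; case: ifP => // _; rewrite preimage_set0 measure0.
congr (_ <= _)%E; congr (Pr M _); apply: eq_set => om.
congr (is_true (_ < _)); rewrite big_sumType/= big1 ?add0r; last first.
  by move=> p _; rewrite asboolF.
rewrite /risk [RHS]big_mkcond/=; apply: eq_bigr => b _.
by rewrite /A /c; case: ifP => // _; rewrite asboolF.
Qed.

Lemma prob_bad_perish (R : realType) (T : nat) (M : instance R T) (delta : R) :
  admissible M -> 0 < delta < 1 -> 1 <= ln (T%:R : R) ->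
  (Pr M (~` [set om | good_perish delta om]) <= delta%:E)%E.
Proof.
move=> adm d01 lnT; have T0 : (0 < T)%N.
  by case: (T) lnT => //; rewrite ln0// ler10.
have /andP[d0 d1] := d01.
pose A (i : 'I_T) : set (Omega M) := [set om |
  Defs.eta M delta i.+1 + confP T delta i.+1 (Defs.eta M delta i.+1) <
  risk delta om i.+1].
apply: (@le_trans _ _ (\sum_i Pr M (A i))%E).
  apply: finite_union_bound => [i||om /= ngP].
  - by apply: measurable_primitives => om om' eqp; rewrite /A /= (risk_det _ _ eqp).
  - apply: measurableC; apply: measurable_primitives => om om' eqp.
    exact: good_perish_det.
  apply: contrapT => nA; apply: ngP => t /andP[t1 tT]; rewrite leNgt; apply/negP => bad.
  case: t t1 tT bad => // t _ tT bad.
  by apply: nA; exists (Ordinal tT).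
apply: (@le_trans _ _ (\sum_(i < T) (delta / (3 * i.+1%:R * ln T%:R))%:E)%E).
  by apply: lee_sum => i _; apply: prob_risk_tail => //; rewrite /= ltn_ord.
rewrite sumEFin lee_fin.
have -> : \sum_(i < T) delta / (3 * i.+1%:R * ln T%:R) =
    delta / (3 * ln T%:R) * \sum_(1 <= t < T.+1) (t%:R)^-1 :> R.
  rewrite big_add1/= big_mkord mulr_sumr; apply: eq_bigr => i _.
  by rewrite mulrAC invfM mulrA.
have := sum_inv_le_ln R T.-1; rewrite prednK// => S.
have l0 : 0 < 3 * ln (T%:R : R) by lra.
apply: (@le_trans _ _ (delta / (3 * ln T%:R) * (1 + ln T%:R))).
  by rewrite ler_wpM2l// divr_ge0 ?(ltW d0) ?(ltW l0).
(* What remains is [1 + ln T <= 3 * ln T], from [1 <= ln T]. *)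
rewrite mulrAC ler_pdivrMr// ler_pM2l//; lra.
Qed.

(** * Conclusion *)

Lemma meanN_ge0 (R : realType) (T : nat) (M : instance R T) (s t : nat) :
  0 <= meanN M s t.
Proof.
by apply: fine_ge0; apply: expectation_ge0 => om; exact: arrivals_ge0.
Qed.

Lemma card_Theta_gt0 (R : realType) (T : nat) (M : instance R T) (s t : nat) :
  0 < meanN M s t -> (0 < #|Theta M|)%N.
Proof.
move=> e0; rewrite lt0n; apply: contraTN e0 => /eqP T0.
rewrite -leNgt /meanN /mean (_ : arrivals s t = cst 0) ?expectation_cst//.
apply/funext => om; rewrite /arrivals big1// => u _.
by rewrite big_pred0// => th; move: (card0_eq T0 th).
Qed.

Lemma meanN_le_mu_max (R : realType) (T : nat) (M : instance R T) :
  admissible M -> meanN M 1 T <= T%:R * mu_max M.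
Proof.
move=> adm; rewrite meanN_sum//.
apply: (@le_trans _ _ (\sum_(1 <= u < T.+1) mu_max M)).
  rewrite big_nat [leRHS]big_nat; apply: ler_sum => u uT.
  have -> : \sum_(th : Theta M) mean (narrR u th) = meanN M u u.
    by rewrite meanN_sum ?big_nat1//; case/andP: uT.
  by apply: (le_bigmax_seq 0 _ xpredT (fun t => meanN M t t)); rewrite ?mem_index_iota.
by rewrite sumr_const_nat subn1 mulr_natl.
Qed.

(** This leads to the measurability of the event on the two metrics. *)
Lemma state_det (R : realType) (T : nat) (M : instance R T) (delta L : R)
    (om om' : Omega M) (t : nat) :
  (forall k, primitives k om = primitives k om') -> (t <= T)%N ->
  state delta L om t = state delta L om' t.
Proof.
move=> eqp; elim: t => // t IH tT.
have aE : arrivals t.+1 t.+1 om = arrivals t.+1 t.+1 om' by exact: arrivals_det.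
rewrite /= -IH ?(ltnW tT)//; set st := state delta L om t.
have XE : guardrail delta L t.+1 om st.1 = guardrail delta L t.+1 om' st.1.
  by rewrite /guardrail aE.
rewrite /step XE -!mulr_suml -!arrivals1 aE; congr (_, _).
  by congr (_ - _); apply: eq_bigl => b; rewrite (perish_det b eqp).
by apply/funext => b; rewrite (perish_det b eqp).
Qed.

Lemma Xalg_det (R : realType) (T : nat) (M : instance R T) (delta L : R)
    (om om' : Omega M) (t : nat) (th : Theta M) :
  (forall k, primitives k om = primitives k om') -> (1 <= t <= T)%N ->
  Xalg delta L t th om = Xalg delta L t th om'.
Proof.
move=> eqp /andP[t1 tT]; rewrite /Xalg /guardrail (arrivals_det eqp)//.
by rewrite (state_det _ _ eqp)// (leq_trans (leq_pred t)).
Qed.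

Lemma Delta_EF_det (R : realType) (T : nat) (M : instance R T) (delta L : R)
    (om om' : Omega M) : (forall k, primitives k om = primitives k om') ->
  Delta_EF delta L om = Delta_EF delta L om'.
Proof.
move=> eqp; apply: eq_big_nat => t tT; apply: eq_bigr => th _.
by rewrite (Xalg_det _ _ _ eqp)// (arrivals_det eqp).
Qed.

Lemma Delta_eff_det (R : realType) (T : nat) (M : instance R T) (delta L : R)
    (om om' : Omega M) : (forall k, primitives k om = primitives k om') ->
  Delta_eff delta L om = Delta_eff delta L om'.
Proof.
move=> eqp; congr (_ - _); apply: eq_big_nat => t tT; apply: eq_bigr => th _.
rewrite (Xalg_det _ _ _ eqp)//; congr (_ * _).
have /andP[t1 tT'] := tT; have uT : (t.-1 < T)%N by rewrite prednK.
by have := eqp (inl (Ordinal uT, th)); rewrite /= prednK// /narrR => ->.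
Qed.

(** The bounds [c1] and [c2] are only required when [0 <= Lperish]: this sign is obtained on an
    outcome with good forecasts, from [0 <= late <= Delta_bar]. *)
Lemma guardrail_performance (R : realType) (T : nat) (M : instance R T)
    (delta L c1 c2 : R) :
  admissible M -> 0 < delta < 1 -> 1 <= ln (T%:R : R) -> 0 < meanN M 1 T ->
  feasible_rates M delta (Xlow M delta) -> 0 <= L ->
  (0 <= Lperish M delta -> w_max M * (Lperish M delta + L +
     2 * beta_avg M * confN M delta 0 T / T%:R) <= c1) ->
  (0 <= Lperish M delta -> 2 * beta_avg M * confN M delta 0 T +
     Nup M delta * Lperish M delta <= c2) ->
  ((1 - 2 * delta)%:E <= Pr M [set om : Omega M |
     (Delta_EF delta L om <= c1)%R /\ (Delta_eff delta L om <= c2)%R])%E.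
Proof.
move=> adm d01 lnT e0 feas L0 c1P c2P.
have T0 : (0 < T)%N by case: (T) lnT => //; rewrite ln0// ler10.
set E := [set om | _ /\ _].
pose G1 : set (Omega M) := [set om | good_arrivals delta om].
pose G2 : set (Omega M) := [set om | good_perish delta om].
(* This event is almost sure and costs no probability; it yields [T <= N]. *)
pose G3 : set (Omega M) := [set om |
  forall (i : 'I_T) (th : Theta M), (1 <= narr i.+1 th om)%N].
have mG1 : measurable G1.
  by apply: measurable_primitives => om om'; exact: good_arrivals_det.
have mG2 : measurable G2.
  by apply: measurable_primitives => om om'; exact: good_perish_det.
have mG3 : measurable G3.
  apply: measurable_primitives => om om' eqp h i th.
  by have := eqp (inl (i, th)); rewrite /= => <-.
have mE : measurable E.
  apply: measurable_primitives => om om' eqp; rewrite /E /=.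
  by rewrite (Delta_EF_det _ _ eqp) (Delta_eff_det _ _ eqp).
have G30 : Pr M (~` G3) = 0.
  apply: ae_set0 => //; apply: filter_forall => i; apply: filter_forall => th.
  by apply: (narr_ge1 adm); rewrite /= ltn_ord.
have Nup0 : 0 < Nup M delta by rewrite ltr_pwDl// sqrtr_ge0.
have GE : G1 `&` G2 `&` G3 `<=` E.
  move=> om [[g1 g2] g3].
  have Xrate := rate_low_or_high adm L0 Nup0 feas g1 g2.
  have Lp0 : 0 <= Lperish M delta.
    apply: Lperish_ge0 => //; apply: le_trans (late_ge0 delta om 1) _.
    by apply: late_le_Delta_bar => //; case: feas.
  have NT : T%:R <= arrivals 1 T om.
    apply: arrivals_ge_T (card_Theta_gt0 e0) _ => t th /andP[t1 tT].
    have tT' : (t.-1 < T)%N by rewrite prednK.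
    by have := g3 (Ordinal tT') th; rewrite /= prednK.
  have dev := g1 1%N T isT (leqnn T).
  split.
    apply: le_trans (c1P Lp0); apply: Delta_EF_bound => //.
      exact: (weight_gt0 adm).
    by rewrite ltr0n.
  exact: le_trans (Delta_eff_bound L0 e0 dev Lp0 Xrate) (c2P Lp0).
have cE : (Pr M (~` E) <= Pr M (~` G1) + Pr M (~` G2))%E.
  apply: (@le_trans _ _ (Pr M (~` G1 `|` ~` G2))); last by apply: measureU2; exact: measurableC.
  apply: (@measureU_null _ _ _ _ _ _ (~` G3)) => //; try exact: measurableC.
    by apply: measurableU; exact: measurableC.
  by rewrite -!setCI; exact: subsetC.
have dE : (Pr M (~` E) <= (2 * delta)%:E)%E.
  apply: le_trans cE _; rewrite mulr_natl mulr2n EFinD; apply: leeD.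
    exact: prob_bad_arrivals.
  exact: prob_bad_perish.
rewrite -[E]setCK probability_setC; last exact: measurableC.
by rewrite EFinB leeB.
Qed.

(** [expR_le_ratio] at 1 says that [expR 1 <= 3]. *)
Lemma ln_ge1 (R : realType) (T : nat) : (3 <= T)%N -> 1 <= ln (T%:R : R).
Proof.
move=> T3; rewrite -[leLHS](@expRK R) ler_ln ?posrE ?expR_gt0 ?ltr0n ?(leq_trans _ T3)//.
have := @expR_le_ratio R 1 ler01; have : 3 <= T%:R :> R by rewrite ler_nat.
lra.
Qed.

Lemma bigTheta1_neq0 (R : realType) (f : nat -> R) :
  f =Theta_\oo (fun=> 1 : R) -> \forall T \near \oo, f T != 0.
Proof.
rewrite eqThetaE => /asboolP [[k1 k2] /= /andP[k10 _] H].
near=> T; have [h _] : k1 * `|1 : R| <= `|f T| /\ `|f T| <= k2 * `|1 : R|.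
  by near: T.
by rewrite -normr_gt0; apply: lt_le_trans h; rewrite normr1 mulr1.
Unshelve. all: by end_near. Qed.

(** * Polynomial factors and the final bounds *)

Definition Xpoly (R : realType) (i : 'I_9) : mpoly.mpoly 9 R :=
  mpoly.mpolyX R (mpoly.mnm1 i).

Lemma confN_rate_poly (R : realType) : exists q : mpoly.mpoly 9 R,
  forall (T : nat) (M : instance R T) (delta : R),
    poly_factor q M delta = confN_rate M delta.
Proof.
pose X i := Xpoly R (inord i).
(* Variables 6, 1, 7 and 8 are [rho_max], the number of types, [ln T] and [ln delta^-1]. *)
exists (X 6%N * (1 + (X 1%N + X 1%N) * (1 + (X 7%N + X 7%N) + X 8%N))) => T M delta.
rewrite /poly_factor /X /Xpoly.
rewrite !(mpoly.mevalD, mpoly.mevalM, mpoly.meval1, mpoly.mevalXU) !inordK//=.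
by rewrite /confN_rate; ring.
Qed.

Theorem corollary1 (R : realType) (pL : mpoly.mpoly 9 R) :
  exists pEF pEff : mpoly.mpoly 9 R,
  forall (I : forall T : nat, instance R T) (L delta : nat -> R),
    (forall T, (0 < T)%N -> admissible (I T)) ->
    (fun T => meanN (I T) 1 T) =Theta_\oo (fun T => T%:R : R) ->
    (fun T => beta_avg (I T)) =Theta_\oo (fun=> 1 : R) ->
    (forall T, 0 < delta T < 1) ->
    (forall T, (0 < T)%N ->
       feasible_rates (I T) (delta T) (Xlow (I T) (delta T))) ->
    (forall T, 0 <= L T) ->
    L =o_\oo (fun=> 1 : R) ->
    (\forall T \near \oo,
       L T <= poly_factor pL (I T) (delta T) * (1 / Num.sqrt T%:R)) ->
    \forall T \near \oo,
      ((1 - 2 * delta T)%:E <=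
       Pr (I T) [set om : Omega (I T) |
         (Delta_EF (delta T) (L T) om <=
            poly_factor pEF (I T) (delta T) *
              (Lperish (I T) (delta T) + 1 / Num.sqrt T%:R))%R /\
         (Delta_eff (delta T) (L T) om <=
            poly_factor pEff (I T) (delta T) *
              (Num.sqrt T%:R + T%:R * Lperish (I T) (delta T)))%R])%E.
Proof.
have [q qE] := confN_rate_poly R; pose X i := Xpoly R (inord i).
(* Variables 2, 0 and 3 are [w_max], [beta_avg] and [mu_max]; [pL] accounts for [L] and [q] for
   [confN]. The last [q] absorbs [confN * Lperish], the part of [Nup * Lperish] beyond the mean. *)
exists (X 2%N * (1 + pL + (X 0%N + X 0%N) * q)), ((X 0%N + X 0%N) * q + X 3%N + q).
move=> I L delta adm _ beta d01 feas L0 _.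
apply: filter_app; have := bigTheta1_neq0 beta; apply: filter_app.
near=> T => beta0 LT.
have T3 : (3 <= T)%N by near: T; exact: nbhs_infty_ge.
have T0 : (0 < T)%N by exact: leq_trans T3.
have e0 : 0 < meanN (I T) 1 T.
  (* Division by 0 gives 0, so a nonzero [beta_avg] forces a nonzero mean. *)
  rewrite lt_def meanN_ge0 andbT; apply: contra_neq beta0 => e0.
  by rewrite /beta_avg e0 invr0 mulr0.
have T1 : 1 <= T%:R :> R by rewrite ler1n.
have rT : Num.sqrt T%:R <= T%:R :> R.
  rewrite -[leRHS]ger0_norm ?ler0n// -sqrtr_sqr ler_wsqrtr//.
  by rewrite expr2 ler_peMl ?ler0n.
have r0 : 0 < Num.sqrt T%:R :> R by rewrite sqrtr_gt0 ltr0n.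
have rE : Num.sqrt T%:R / T%:R = 1 / Num.sqrt T%:R :> R.
  rewrite -{2}[T%:R](@sqr_sqrtr R) ?ler0n// expr2 invfM mulrA divff ?gt_eqF//.
have cN := confN_le (I T) T0 (d01 T).
have q0 : 0 <= confN_rate (I T) (delta T).
  have := le_trans (sqrtr_ge0 _) cN; by rewrite pmulr_rge0.
have be0 : 0 <= beta_avg (I T) by rewrite divr_ge0 ?ler0n ?(ltW e0).
have w0 : 0 <= w_max (I T) by exact: bigmax_ge_id.
have mu0 : 0 <= mu_max (I T) by exact: bigmax_ge_id.
have pL0 : 0 <= poly_factor pL (I T) (delta T).
  by have := le_trans (L0 T) LT; rewrite pmulr_lge0// divr_gt0.
have bq0 := mulr_ge0 be0 q0; have bb0 := mulr_ge0 (ler0n R 2) be0.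
have T0' : 0 < T%:R :> R by rewrite ltr0n.
apply: guardrail_performance => //; [exact: adm | exact: ln_ge1 | exact: feas | |] => Lp0.
  rewrite /poly_factor.
  rewrite !(mpoly.mevalD, mpoly.mevalM, mpoly.meval1, mpoly.mevalXU).
  rewrite -/(poly_factor pL (I T) (delta T)) -/(poly_factor q (I T) (delta T)) qE.
  rewrite !inordK//= -[leRHS]mulrA ler_wpM2l//.
  have := ler_wpM2l bb0 cN; rewrite -(ler_pM2r (_ : 0 < T%:R^-1)) ?invr_gt0//.
  have -> : 2 * beta_avg (I T) * (Num.sqrt T%:R * confN_rate (I T) (delta T)) / T%:R =
      2 * (beta_avg (I T) * confN_rate (I T) (delta T)) * (Num.sqrt T%:R / T%:R) by ring.
  rewrite rE; have r1 := divr_ge0 (@ler01 R) (ltW r0).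
  have := mulr_ge0 pL0 Lp0; have := mulr_ge0 bq0 Lp0; lra.
rewrite /poly_factor.
rewrite !(mpoly.mevalD, mpoly.mevalM, mpoly.meval1, mpoly.mevalXU).
rewrite -/(poly_factor q (I T) (delta T)) qE !inordK//=.
have mle := ler_wpM2r Lp0 (meanN_le_mu_max (adm T T0)).
have bcN := ler_wpM2l bb0 cN; have cNLp := ler_wpM2r Lp0 cN.
(* The square root of [T] times [Lperish] is absorbed into [T] times [Lperish]. *)
have rTLp := ler_wpM2r (mulr_ge0 q0 Lp0) rT.
have := mulr_ge0 mu0 (ltW r0); have := mulr_ge0 q0 (ltW r0).
have := mulr_ge0 bq0 (mulr_ge0 (ltW T0') Lp0).
rewrite /Nup; lra.
Unshelve. all: by end_near. Qed.
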